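(* Let $h:\mathbb{C}\to\mathbb{R}$ be a smooth map and $E_h:=\{x+iy\in\mathbb{C} : h(x,y)=0\}$ with $dh\neq 0$ on $E_h$. Let $K$ be a connected, simply-coconnected compact subset of $M:=E_h\times\mathbb{C}$ such that each fiber $K_c:=\{w\in\mathbb{C} : (c,w)\in K\}$ is polynomially convex. Then $K$ is polynomially convex.
   Context: A compact set $K\subset\mathbb{C}^n$ is simply-coconnected if for every continuous map $f:K\to\mathbb{C}\setminus\{0\}$ there is a continuous map $\psi:K\to\mathbb{C}$ with $f=\exp(\psi)$ (equivalently, $\check{H}^1(K;\mathbb{Z})=0$). For a compact $K\subset\mathbb{C}^n$, $\widehat{K}:=\{z\in\mathbb{C}^n : |p(z)|\le \sup_K|p| \text{ for all holomorphic polynomials } p\}$, and $K$ is polynomially convex if $\widehat{K}=K$. *)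

(* Defs.v *)
(* C is modelled as R * R (real coordinates x + iy ~ (x,y))
   with its standard product topology; complex arithmetic is done in R[i]
   (mathcomp-real-closed) through the identification [toC]. *)
From HB Require Import structures.
From mathcomp Require Import all_boot all_order all_algebra.
From mathcomp Require Import all_classical all_reals all_analysis.
From mathcomp Require Import complex.
Import Order.TTheory GRing.Theory Num.Theory.
Import numFieldNormedType.Exports.
Local Open Scope ring_scope.
Local Open Scope classical_set_scope.

Set Implicit Arguments.
Unset Strict Implicit.
Unset Printing Implicit Defensive.

Section Defs.
Variable R : realType.

Definition toC (u : R * R) : R[i] := (u.1 +i* u.2)%C.

Definition cmod (z : R[i]) : R := ComplexField.Normc.normc z.

Definition cexp (u : R * R) : R * R := (expR u.1 * cos u.2, expR u.1 * sin u.2).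

Fixpoint iter_dir (vs : seq (R * R)) (f : R * R -> R) : R * R -> R :=
  match vs with
  | [::] => f
  | v :: vs' => fun x => 'D_v (iter_dir vs' f) x
  end.

Definition smooth2 (f : R * R -> R) : Prop :=
  forall vs : seq (R * R),
    continuous (iter_dir vs f) /\ (forall (v x : R * R), derivable (iter_dir vs f) x v).

(* evaluation of a holomorphic polynomial in two variables (z1, z2):
   P in (C[z1])[z2], evaluated as P.[z2, z1] = (P.[z2%:P]).[z1] *)
Definition peval2 (P : {poly {poly R[i]}}) (z : (R * R) * (R * R)) : R[i] :=
  P.[toC z.2, toC z.1].

(* polynomial hull in C^2 (|p(z)| <= sup_K |p| written with upper bounds) *)
Definition phull2 (K : set ((R * R) * (R * R))) : set ((R * R) * (R * R)) :=
  [set z | forall (P : {poly {poly R[i]}}) (M : R),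
      (forall k, K k -> cmod (peval2 P k) <= M) -> cmod (peval2 P z) <= M].

Definition polyconvex2 (K : set ((R * R) * (R * R))) : Prop := phull2 K = K.

Definition phull1 (S : set (R * R)) : set (R * R) :=
  [set w | forall (p : {poly R[i]}) (M : R),
      (forall u, S u -> cmod p.[toC u] <= M) -> cmod p.[toC w] <= M].

Definition polyconvex1 (S : set (R * R)) : Prop := phull1 S = S.

Definition simply_coconnected (K : set ((R * R) * (R * R))) : Prop :=
  forall f : (R * R) * (R * R) -> R * R,
    {within K, continuous f} -> (forall k, K k -> f k != 0) ->
    exists psi : (R * R) * (R * R) -> R * R,
      {within K, continuous psi} /\ (forall k, K k -> f k = cexp (psi k)).

Definition fiber (K : set ((R * R) * (R * R))) (c : R * R) : set (R * R) :=
  [set w | K (c, w)].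

End Defs.

(* Main.v *)
(* Let [G] be the projection of [K] to the first coordinate [c], and [A] the uniform
   algebra generated on [K] by the polynomials.  Call [l] outside [G] free when
   [1 / (c - l)] lies in [A].  Freeness is locally constant off [G] and holds near
   infinity; since [G] is connected, each of the two sides [h > 0], [h < 0] of [G]
   is entirely free or entirely not free, and one of them, say [h < 0], is free.
   Discs tangent to [G] on the free side give functions of [A] peaking at any [p] in
   [G], so that for [l] near [p] the norm of a polynomial in [w] modulo [c - l] is
   controlled by its supremum on the fibre over [p].

   If the side [h > 0] is not free, take [l0] there and write [c - l0 = exp psi] on
   [K].  By Runge's theorem the part [Im psi > t] of a fibre is cut out by a
   polynomial in [w], which is almost idempotent modulo [c - l] for [l] close to the
   fibre; whether it is alive (not small) there is constant along the side [h > 0].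
   The largest value of [Im psi] whose sheet is alive is then a continuous argument
   of [c - l0] on [G], which is impossible because [l0] lies in a bounded open set
   with frontier in [G].  So both sides are free, the hull of [K] lies over [G], and
   peak functions reduce the claim to the polynomial convexity of the fibres. *)
Require Import Defs.
From HB Require Import structures.
From mathcomp Require Import all_boot all_order all_algebra.
From mathcomp Require Import all_classical all_reals all_analysis.
From mathcomp Require Import complex.
From mathcomp Require Import ring lra.
Import Order.TTheory GRing.Theory Num.Theory.
Import numFieldNormedType.Exports.
Local Open Scope ring_scope.
Local Open Scope classical_set_scope.

Set Implicit Arguments.
Unset Strict Implicit.

Local Arguments cmod : simpl never.
Local Arguments toC : simpl never.

(** * The complex modulus on pairs of reals *)

Section Modulus.
Variable R : realType.
Implicit Types (z w : R[i]) (x y : R * R).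

(** The obstacle is that [Im psi] lives on [K] and not on [G]: a fibre may be disconnected and carry
    several values, differing by multiples of 2 pi, and these sheets may begin or end as the fibre
    moves. One sheet is singled out by the quotient of [A] by the ideal of [c - l], which for [l]
    off [G] is nonzero exactly when [l] is not free: in it the sheets above a level give an
    idempotent, and whether this vanishes cannot change as [l] moves along the side. The quotient is
    never built. [qnorm] bounds its norm, and idempotents are only approximate; as an idempotent has
    norm 0 or at least 1, the alternative survives small errors. The free side makes the fibres
    visible from the other one: it supplies peak functions inside [A], and these control the
    quotient norm on both sides of [G]. *)

Lemma cmodM z w : cmod (z * w) = cmod z * cmod w.
Proof. exact: ComplexField.Normc.normcM. Qed.

Lemma cmodV z : cmod z^-1 = (cmod z)^-1.
Proof. exact: ComplexField.Normc.normcV. Qed.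

Lemma cmodD z w : cmod (z + w) <= cmod z + cmod w.
Proof. exact: le_normcD. Qed.

Lemma cmodN z : cmod (- z) = cmod z.
Proof. exact: normcN. Qed.

Lemma cmod0 : cmod (0 : R[i]) = 0.
Proof. exact: ComplexField.Normc.normc0. Qed.

Lemma cmod1 : cmod (1 : R[i]) = 1.
Proof. exact: ComplexField.Normc.normc1. Qed.

Lemma cmod_ge0 z : 0 <= cmod z.
Proof. by case: z => a b; exact: sqrtr_ge0. Qed.

Lemma cmod_eq0 z : (cmod z == 0) = (z == 0).
Proof.
apply/eqP/eqP => [|->]; last exact: cmod0.
exact: ComplexField.Normc.eq0_normc.
Qed.

Lemma cmod_gt0 z : (0 < cmod z) = (z != 0).
Proof. by rewrite lt0r cmod_ge0 andbT cmod_eq0. Qed.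

Lemma cmodX z n : cmod (z ^+ n) = cmod z ^+ n.
Proof. by elim: n => [|n IH]; rewrite ?expr0 ?cmod1// !exprS cmodM IH. Qed.

Lemma cmodC z w : cmod (z - w) = cmod (w - z).
Proof. by rewrite -cmodN opprB. Qed.

Lemma cmodB z w : cmod (z - w) <= cmod z + cmod w.
Proof. by rewrite -(cmodN w) cmodD. Qed.

Lemma cmod_lerB z w : cmod z - cmod w <= cmod (z - w).
Proof. by have := cmodD (z - w) w; rewrite subrK; lra. Qed.

Lemma cmod_tri w z z' : cmod (z - z') <= cmod (z - w) + cmod (w - z').
Proof. by have := cmodD (z - w) (w - z'); rewrite addrA subrK. Qed.

Lemma cmod_real (r : R) : cmod r%:C%C = `|r|.
Proof. by rewrite /cmod /= expr0n /= addr0 sqrtr_sqr. Qed.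

Lemma toCB x y : toC (x - y) = toC x - toC y.
Proof. by []. Qed.

Lemma toCD x y : toC (x + y) = toC x + toC y.
Proof. by []. Qed.

Lemma toC_inj x y : toC x = toC y -> x = y.
Proof. by case: x y => [a b] [c d] [-> ->]. Qed.

Lemma toCK z : toC (complex.Re z, complex.Im z) = z.
Proof. by case: z. Qed.

Lemma cmod_sqr x : cmod (toC x) ^+ 2 = x.1 ^+ 2 + x.2 ^+ 2.
Proof. by rewrite /cmod /= sqr_sqrtr// addr_ge0// sqr_ge0. Qed.

Lemma cmod_fst x : `|x.1| <= cmod (toC x).
Proof.
rewrite -(@ler_pXn2r _ 2)// ?nnegrE ?cmod_ge0// cmod_sqr real_normK ?num_real//.
by rewrite lerDl sqr_ge0.
Qed.

Lemma cmod_snd x : `|x.2| <= cmod (toC x).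
Proof.
rewrite -(@ler_pXn2r _ 2)// ?nnegrE ?cmod_ge0// cmod_sqr real_normK ?num_real//.
by rewrite lerDr sqr_ge0.
Qed.

Lemma cmod_le_sum x : cmod (toC x) <= `|x.1| + `|x.2|.
Proof.
rewrite -(@ler_pXn2r _ 2)// ?nnegrE ?cmod_ge0 ?addr_ge0// cmod_sqr sqrrD.
rewrite !real_normK ?num_real// -addrA [_ *+ 2 + _]addrC addrA lerDl.
by rewrite mulrn_wge0// mulr_ge0.
Qed.

Lemma near_cmodP x (P : R * R -> Prop) :
  (\forall y \near x, P y) <->
  exists2 r : R, 0 < r & forall y, cmod (toC (y - x)) < r -> P y.
Proof.
split.
  case/nbhs_ballP => r r0 rP; exists r => // y yr; apply: rP.
  split; rewrite /ball /= distrC.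
    exact: le_lt_trans (cmod_fst (y - x)) yr.
  exact: le_lt_trans (cmod_snd (y - x)) yr.
case=> r r0 rP; apply/nbhs_ballP; exists (r / 2); first by rewrite /= divr_gt0.
move=> y [/= y1 y2]; apply: rP; apply: le_lt_trans (cmod_le_sum _) _ => /=.
by rewrite distrC [X in _ + X]distrC; move: y1 y2; rewrite /ball /=; lra.
Qed.

End Modulus.

(** * Runge approximation of the indicator of a clopen part *)

Section Runge.
Variable R : realType.
Local Notation C := R[i].
Implicit Types (S P : set C) (F G : C -> C).

Definition poly_appr S F (M : R) :=
  exists a : {poly C}, forall u, S u -> cmod (F u - a.[u]) <= M.

Definition indic_inv P (l u : C) : C := if pselect (P u) then (u - l)^-1 else 0.

Lemma poly_appr_le S F M M' : M <= M' -> poly_appr S F M -> poly_appr S F M'.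
Proof. by move=> le [a aF]; exists a => u /aF /le_trans; apply. Qed.

Lemma poly_appr_eq S F G M :
  (forall u, S u -> F u = G u) -> poly_appr S F M -> poly_appr S G M.
Proof. by move=> FG [a aF]; exists a => u Su; rewrite -FG// aF. Qed.

Lemma poly_apprD S F G M M' : poly_appr S F M -> poly_appr S G M' ->
  poly_appr S (fun u => F u + G u) (M + M').
Proof.
move=> [a aF] [b bG]; exists (a + b) => u Su; rewrite hornerD.
by rewrite opprD addrACA (le_trans (cmodD _ _))// lerD ?aF ?bG.
Qed.

Lemma poly_apprZ S F (k : C) M : poly_appr S F M ->
  poly_appr S (fun u => k * F u) (cmod k * M).
Proof.
move=> [a aF]; exists (k *: a) => u Su; rewrite hornerZ -mulrBr cmodM.
by rewrite ler_wpM2l ?cmod_ge0 ?aF.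
Qed.

Lemma poly_appr_bound S F M : (forall u, S u -> cmod (F u) <= M) -> poly_appr S F M.
Proof. by move=> FM; exists 0 => u Su; rewrite horner0 subr0 FM. Qed.

Definition separated_by_poly S (l : C) := exists (p : {poly C}) (M : R),
  (forall u, S u -> cmod p.[u] <= M) /\ M < cmod p.[l].

(** Scale [p] to [q] with [q(l) = 1] and modulus at most [t < 1] on [S]. Then [1 - q^n] is divisible
    by [X - l], and the quotient differs from [1 / (u - l)] by [q^n / (u - l)]. *)
Lemma poly_appr_inv S (l : C) (d e : R) : separated_by_poly S l -> 0 < d -> 0 < e ->
  (forall u, S u -> d <= cmod (u - l)) -> poly_appr S (fun u => (u - l)^-1) e.
Proof.
move=> [p [M [pM Ml]]] d0 e0 dl.
have [S0|S0] := pselect (forall u, ~ S u); first by exists 0 => u /S0.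
have [v Sv] : exists v, S v.
  by apply: contrapT => H; apply: S0 => u Su; apply: H; exists u.
have M0 : 0 <= M by apply: le_trans (pM _ Sv); exact: cmod_ge0.
have pl0 : 0 < cmod p.[l] by exact: le_lt_trans Ml.
pose q := (p.[l])^-1 *: p.
have ql : q.[l] = 1 by rewrite hornerZ mulVf// -cmod_gt0.
pose t := M / cmod p.[l].
have t0 : 0 <= t by rewrite divr_ge0// cmod_ge0.
have t1 : t < 1 by rewrite ltr_pdivrMr// mul1r.
have qt u : S u -> cmod q.[u] <= t.
  by move=> Su; rewrite hornerZ cmodM cmodV mulrC ler_wpM2r ?invr_ge0 ?cmod_ge0 ?pM.
have [n tn] : exists n, t ^+ n < e * d.
  have : (GRing.exp t) @ \oo --> (0 : R) by apply: cvg_expr; rewrite ger0_norm.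
  move=> /cvgr0Pnorm_lt /(_ _ (mulr_gt0 e0 d0)) [n _ /(_ n (leqnn n))].
  by rewrite ger0_norm ?exprn_ge0//; exists n.
have : root (1 - q ^+ n) l by rewrite rootE hornerD hornerN horner_exp ql expr1n hornerC subrr.
case/factor_theorem => a aE; exists a => u Su.
have dlu := dl _ Su.
have ul0 : u - l != 0 by rewrite -cmod_gt0 (lt_le_trans d0).
have -> : (u - l)^-1 - a.[u] = q.[u] ^+ n / (u - l).
  have := congr1 (fun b : {poly C} => b.[u]) aE.
  rewrite !(hornerM, hornerD, hornerN, hornerC, hornerX, horner_exp).
  move=> /eqP; rewrite subr_eq => /eqP E.
  apply: (mulIf ul0); rewrite mulrBl mulVf// mulfVK//.
  by apply/eqP; rewrite subr_eq addrC; apply/eqP.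
rewrite cmodM cmodV cmodX ler_pdivrMr ?(lt_le_trans d0)//.
apply: (@le_trans _ _ (t ^+ n)); first by rewrite lerXn2r ?nnegrE ?cmod_ge0 ?qt.
by rewrite (le_trans (ltW tn))// ler_wpM2l// ltW.
Qed.


Lemma poly_appr_far S P (l : C) (B d : R) : 0 < d ->
  (forall u, S u -> cmod u <= B) -> B + d <= cmod l ->
  poly_appr S (indic_inv P l) d^-1.
Proof.
move=> d0 SB Bl.
apply: poly_appr_bound => u Su; rewrite /indic_inv.
case: pselect => ?; last by rewrite cmod0 invr_ge0 ltW.
have dlu : d <= cmod (u - l).
  by rewrite cmodC; have := cmod_lerB l u; have := SB _ Su; lra.
by rewrite cmodV lef_pV2 ?posrE ?(lt_le_trans d0).
Qed.

(* The four-point mean of [1 / (x - t)] over [t = s, -s, is, -is] is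
   [x^3 / (x^4 - s^4)]: a discrete mean value property up to order 4. *)
Lemma mean_inv (x : C) (s d : R) (i := ('i)%C : C) (t := (s%:C)%C : C) :
  0 < s -> 2 * s <= d -> d <= cmod x ->
  cmod (x^-1 - 4^-1 * ((x - t)^-1 + (x + t)^-1 + (x - i * t)^-1 + (x + i * t)^-1))
    <= 2 * s ^+ 4 / d ^+ 5.
Proof.
move=> s0 sd dx.
have d0 : 0 < d by lra.
have x0 : 0 < cmod x by lra.
have ct : cmod t = s by rewrite cmod_real gtr0_norm.
have i2 : i * i = -1 by rewrite -expr2 sqr_i.
have ci : cmod i = 1 by rewrite /i /cmod /= expr0n expr1n add0r sqrtr1.
have nz (y : C) : cmod y <= s -> x - y != 0.
  move=> ys; rewrite -cmod_gt0; have := cmod_lerB x y; lra.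
have h1 : x - t != 0 by apply: nz; rewrite ct.
have h2 : x + t != 0 by rewrite -(opprK t); apply: nz; rewrite cmodN ct.
have h3 : x - i * t != 0 by apply: nz; rewrite cmodM ci ct mul1r.
have h4 : x + i * t != 0.
  by rewrite -(opprK (i * t)); apply: nz; rewrite cmodN cmodM ci ct mul1r.
have h0 : x != 0 by rewrite -cmod_gt0.
have E4 : (x - t) * (x + t) * ((x - i * t) * (x + i * t)) = x ^+ 4 - t ^+ 4.
  have -> : (x - i * t) * (x + i * t) = x ^+ 2 - (i * i) * t ^+ 2 by ring.
  by rewrite i2; ring.
have h5 : x ^+ 4 - t ^+ 4 != 0 by rewrite -E4 !mulf_neq0.
have -> : x^-1 - 4^-1 * ((x - t)^-1 + (x + t)^-1 + (x - i * t)^-1 + (x + i * t)^-1)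
  = - t ^+ 4 / (x * (x ^+ 4 - t ^+ 4)).
  have -> : (x - t)^-1 + (x + t)^-1 + (x - i * t)^-1 + (x + i * t)^-1 =
     4 * x ^+ 3 / (x ^+ 4 - t ^+ 4).
    have -> : (x - t)^-1 + (x + t)^-1 = 2 * x / ((x - t) * (x + t)).
      by field; rewrite h1 h2.
    have e : (x - i * t)^-1 + (x + i * t)^-1 = 2 * x / ((x - i * t) * (x + i * t)).
      by field; rewrite h3 h4.
    rewrite -addrA e -E4.
    have -> : 2 * x / ((x - t) * (x + t)) + 2 * x / ((x - i * t) * (x + i * t)) =
      (2 * x * ((x - i * t) * (x + i * t)) + 2 * x * ((x - t) * (x + t))) /
       ((x - t) * (x + t) * ((x - i * t) * (x + i * t))).
      by field; rewrite h1 h2 h3 h4.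
    congr (_ / _).
    have -> : (x - i * t) * (x + i * t) = x ^+ 2 - (i * i) * t ^+ 2 by ring.
    by rewrite i2; ring.
  have f4 : (4 : C) != 0 by rewrite pnatr_eq0.
  by field; rewrite h0 h5.
rewrite cmodM cmodN cmodX ct cmodV cmodM.
have k4 : d ^+ 4 / 2 <= cmod (x ^+ 4 - t ^+ 4).
  have := cmod_lerB (x ^+ 4) (t ^+ 4); rewrite !cmodX ct.
  have : d ^+ 4 <= cmod x ^+ 4 by apply: lerXn2r; rewrite ?nnegrE ?cmod_ge0// ltW.
  have : s ^+ 4 <= (d / 2) ^+ 4 by apply: lerXn2r; rewrite ?nnegrE; lra.
  have := exprn_gt0 4 d0; rewrite expr_div_n; lra.
have d4 := exprn_gt0 4 d0.
have k5 : d ^+ 5 / 2 <= cmod x * cmod (x ^+ 4 - t ^+ 4).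
  by rewrite exprS -mulrA ler_pM//; lra.
have d5 := exprn_gt0 5 d0.
apply: (@le_trans _ _ (s ^+ 4 / (d ^+ 5 / 2))); last by rewrite invf_div mulrA mulrAC mulrC mulrA.
have s4 : 0 <= s ^+ 4 by rewrite exprn_ge0// ltW.
by rewrite ler_wpM2l// lef_pV2 ?posrE; lra.
Qed.

Definition far P (l : C) (r : R) := forall x, P x -> r <= cmod (x - l).

(** * Resolvents cut to one part of a separated set *)

Section Separation.
Variables (S : set C) (d B : R).
Hypotheses (d0 : 0 < d) (SB : forall u, S u -> cmod u <= B).
Hypothesis S_pc : forall l, ~ S l -> separated_by_poly S l.

(* On [S = P + P'] the functions [1_P / (u - l)] and [- 1_P' / (u - l)] differ
   by [1 / (u - l)], hence agree modulo uniform limits of polynomials whenever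
   both make sense: together they form an entire function of [l]. *)
Definition resolvent_appr P P' (l : C) (M : R) :=
  (far P l (d / 2) /\ poly_appr S (indic_inv P l) M) \/
  (far P' l (d / 2) /\ poly_appr S (indic_inv P' l) M).

Definition separated_cover P P' :=
  (forall u, S u <-> P u \/ P' u) /\
  (forall x y, P x -> P' y -> d <= cmod (x - y)).

Lemma separated_cover_sym P P' : separated_cover P P' -> separated_cover P' P.
Proof.
move=> [cov sep]; split=> [u|x y]; first by rewrite cov; tauto.
by move=> P'x Py; rewrite cmodC sep.
Qed.

Lemma far_or P P' l : separated_cover P P' -> far P l (d / 2) \/ far P' l (d / 2).
Proof.
move=> [_ sep]; have [?|/existsNP[x /not_implyP[Px /negP]]] := pselect (far P l (d / 2)).
  by left.
rewrite -ltNge => xl; right=> y P'y.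
have := cmod_tri l x y; have := sep _ _ Px P'y; rewrite (cmodC l y); lra.
Qed.

(** If only the [P'] alternative is at hand, [1_P / (u - l)] is [1 / (u - l)] minus
    [1_P' / (u - l)]. The full resolvent is a limit of polynomials because [l] lies off [S]; hence
    the arbitrarily small cost [e]. *)
Lemma resolvent_apprP P P' l (r M e : R) : separated_cover P P' -> 0 < r -> 0 < e ->
  far P l r -> resolvent_appr P P' l M -> poly_appr S (indic_inv P l) (M + e).
Proof.
move=> [cov sep] r0 e0 Pr [[_ ap]|[P'd ap]]; first by apply: poly_appr_le ap; lra.
pose m := Num.min r (d / 2).
have m0 : 0 < m by rewrite lt_min r0 divr_gt0.
have Sm u : S u -> m <= cmod (u - l).
  by move=> /cov[/Pr|/P'd]; apply: le_trans; rewrite ge_min lexx ?orbT.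
have nSl : ~ S l by move=> /Sm; rewrite subrr cmod0 leNgt m0.
have := poly_apprD (poly_apprZ (-1) ap) (poly_appr_inv (S_pc nSl) m0 e0 Sm).
rewrite cmodN cmod1 mul1r; apply: poly_appr_eq => u /cov Pu.
rewrite /indic_inv; case: pselect => P'u; case: pselect => Pu' //=.
- by have := sep _ _ Pu' P'u; rewrite subrr cmod0 leNgt d0.
- by rewrite mulN1r addNr.
- by rewrite mulr0 add0r.
- by case: Pu.
Qed.

(** A shift by [s <= d / 4] keeps [P] at distance [d / 4], so all four neighbouring values can be
    read on the part [P], whichever alternative they came with; [mean_inv] bounds what their mean
    misses. *)
Lemma resolvent_mean_aux P P' (l : C) (s e M M1 M2 M3 M4 : R)
    (i := ('i)%C : C) (t := (s%:C)%C : C) :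
  separated_cover P P' -> 0 < s -> s <= d / 4 -> 0 < e ->
  resolvent_appr P P' (l + t) M1 -> resolvent_appr P P' (l - t) M2 ->
  resolvent_appr P P' (l + i * t) M3 -> resolvent_appr P P' (l - i * t) M4 ->
  (M1 + M2 + M3 + M4) / 4 + e + 2 * s ^+ 4 / (d / 2) ^+ 5 <= M ->
  far P l (d / 2) -> resolvent_appr P P' l M.
Proof.
move=> cov s0 sd e0 a1 a2 a3 a4 leM farP; left; split => //.
have ct : cmod t = s by rewrite cmod_real gtr0_norm.
have ci : cmod i = 1 by rewrite /i /cmod /= expr0n expr1n add0r sqrtr1.
have d4 : 0 < d / 4 by lra.
have near_far v : cmod v <= s -> far P (l + v) (d / 4).
  move=> vs x /farP; rewrite opprD addrA; have := cmod_lerB (x - l) v; lra.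
have b1 : poly_appr S (indic_inv P (l + t)) (M1 + e).
  by apply: (resolvent_apprP cov d4 e0 _ a1); apply: near_far; rewrite ct.
have b2 : poly_appr S (indic_inv P (l - t)) (M2 + e).
  by apply: (resolvent_apprP cov d4 e0 _ a2); apply: near_far; rewrite cmodN ct.
have b3 : poly_appr S (indic_inv P (l + i * t)) (M3 + e).
  by apply: (resolvent_apprP cov d4 e0 _ a3); apply: near_far; rewrite cmodM ci ct mul1r.
have b4 : poly_appr S (indic_inv P (l - i * t)) (M4 + e).
  apply: (resolvent_apprP cov d4 e0 _ a4); apply: near_far.
  by rewrite cmodN cmodM ci ct mul1r.
pose mean u := 4^-1 * (indic_inv P (l + t) u + indic_inv P (l - t) u +
  indic_inv P (l + i * t) u + indic_inv P (l - i * t) u) : C.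
have c4 : cmod (4^-1 : C) = 4^-1.
  rewrite (_ : 4^-1 = (4^-1 : R)%:C%C) ?cmod_real ?ger0_norm ?invr_ge0//.
  by rewrite rmorphV ?unitfE//= rmorph_nat.
have bm : poly_appr S mean ((M1 + M2 + M3 + M4) / 4 + e).
  have := poly_apprZ (4^-1) (poly_apprD (poly_apprD (poly_apprD b1 b2) b3) b4).
  by apply: poly_appr_le; rewrite c4; lra.
have be : poly_appr S (fun u => indic_inv P l u - mean u) (2 * s ^+ 4 / (d / 2) ^+ 5).
  apply: poly_appr_bound => u Su; rewrite /mean /indic_inv.
  case: pselect => Pu; last first.
    rewrite !addr0 mulr0 subr0 cmod0 mulr_ge0 ?mulr_ge0 ?exprn_ge0 ?invr_ge0 ?exprn_ge0//; lra.
  rewrite !opprD !opprK !addrA; apply: mean_inv => //; first lra.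
  exact: farP.
apply: poly_appr_le (poly_appr_eq _ (poly_apprD bm be)); first exact: leM.
by move=> u _; rewrite addrC subrK.
Qed.

Lemma resolvent_mean P P' (l : C) (s e M M1 M2 M3 M4 : R)
    (i := ('i)%C : C) (t := (s%:C)%C : C) :
  separated_cover P P' -> 0 < s -> s <= d / 4 -> 0 < e ->
  resolvent_appr P P' (l + t) M1 -> resolvent_appr P P' (l - t) M2 ->
  resolvent_appr P P' (l + i * t) M3 -> resolvent_appr P P' (l - i * t) M4 ->
  (M1 + M2 + M3 + M4) / 4 + e + 2 * s ^+ 4 / (d / 2) ^+ 5 <= M ->
  resolvent_appr P P' l M.
Proof.
move=> cov s0 sd e0 a1 a2 a3 a4 leM.
have sw P1 P2 k N : resolvent_appr P1 P2 k N -> resolvent_appr P2 P1 k N.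
  by case; [right|left].
have [farP|farP'] := far_or l cov.
  exact: resolvent_mean_aux a1 a2 a3 a4 leM farP.
apply: (sw); apply: (resolvent_mean_aux (separated_cover_sym cov) s0 sd e0 _ _ _ _ leM farP').
- exact: sw a1.
- exact: sw a2.
- exact: sw a3.
- exact: sw a4.
Qed.

Lemma cmod2E (z : C) : cmod z ^+ 2 = complex.Re z ^+ 2 + complex.Im z ^+ 2.
Proof. by case: z => a b; exact: (cmod_sqr (a, b)). Qed.

(* Adding [eps |l|^2] makes the modulus of the resolvent strictly subharmonic,
   so that each application of the mean value inequality gains [k]. *)
Lemma resolvent_descent P P' (s e eps eta k L : R) :
  separated_cover P P' -> 0 < s -> s <= d / 4 -> 0 < e -> 0 < eps -> 0 < eta ->
  0 <= k -> e + k + 2 * s ^+ 4 / (d / 2) ^+ 5 <= eps * s ^+ 2 ->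
  B + eta^-1 <= L -> B + d <= L ->
  forall n l, cmod l <= L + s -> resolvent_appr P P' l
    (eta + eps * ((L + s) ^+ 2 - cmod l ^+ 2) + Num.max 0 (2 / d - n%:R * k)).
Proof.
move=> cov s0 sd e0 eps0 eta0 k0 gain BL BdL n.
have L2 l : cmod l <= L + s -> 0 <= eps * ((L + s) ^+ 2 - cmod l ^+ 2).
  move=> lL; apply: mulr_ge0; [exact: ltW|rewrite subr_ge0].
  by apply: lerXn2r; rewrite ?nnegrE ?cmod_ge0//; apply: le_trans lL; exact: cmod_ge0.
elim: n => [|n IH] l lL.
  have half0 : 0 < d / 2 by lra.
  have bnd Q : far Q l (d / 2) -> poly_appr S (indic_inv Q l)
      (eta + eps * ((L + s) ^+ 2 - cmod l ^+ 2) + Num.max 0 (2 / d - 0%:R * k)).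
    move=> farQ; apply: poly_appr_bound => u Su.
    have M1 : 2 / d <= eta + eps * ((L + s) ^+ 2 - cmod l ^+ 2) + Num.max 0 (2 / d - 0%:R * k).
      have := L2 _ lL; have : 2 / d <= Num.max 0 (2 / d - 0%:R * k).
        by rewrite le_max mul0r subr0 lexx orbT.
      lra.
    apply: le_trans M1; rewrite /indic_inv; case: pselect => Qu.
      by rewrite cmodV -[2 / d]invf_div lef_pV2 ?posrE// ?farQ// (lt_le_trans half0)// farQ.
    by rewrite cmod0 divr_ge0// ltW.
  by have [fP|fP'] := far_or l cov; [left|right]; split => //; exact: bnd.
set N := eta + _ + _.
have m0 : 0 <= Num.max 0 (2 / d - n.+1%:R * k) by rewrite le_max lexx.
(* In the outer annulus the cut resolvent is already below [eta] on [S]: these are the boundary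
   values of the descent. *)
have [Ll|lL'] := leP L (cmod l).
  have ie := eta0; rewrite -invr_gt0 in ie.
  left; split.
    move=> x Px; rewrite cmodC; have := cmod_lerB l x.
    have := SB (proj2 (proj1 cov x) (or_introl Px)); lra.
  apply: (@poly_appr_le _ _ eta); first by rewrite /N; have := L2 _ lL; lra.
  by have := @poly_appr_far S P l B eta^-1; rewrite invrK; apply => //; lra.
have sq : cmod (l + s%:C%C) ^+ 2 + cmod (l - s%:C%C) ^+ 2 +
    cmod (l + ('i * s%:C)%C) ^+ 2 + cmod (l - ('i * s%:C)%C) ^+ 2 =
    4 * cmod l ^+ 2 + 4 * s ^+ 2.
  by rewrite !cmod2E; case: (l) => a b /=; ring.
have ct : cmod (s%:C%C : C) = s by rewrite cmod_real gtr0_norm.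
have cit : cmod ('i * s%:C : C)%C = s.
  by rewrite cmodM ct /cmod /= expr0n expr1n add0r sqrtr1 mul1r.
have nb v : cmod v = s -> cmod (l + v) <= L + s.
  by move=> vs; have := cmodD l v; lra.
apply: (resolvent_mean cov s0 sd e0 (IH _ (nb _ ct)) (IH _ (nb _ _)) (IH _ (nb _ cit))
  (IH _ (nb _ _))); rewrite ?cmodN //.
set m := Num.max 0 (2 / d - n%:R * k).
have mk : m <= Num.max 0 (2 / d - n.+1%:R * k) + k.
  rewrite /m ge_max; apply/andP; split; first by lra.
  have : 2 / d - n.+1%:R * k <= Num.max 0 (2 / d - n.+1%:R * k) by rewrite le_max lexx orbT.
  by rewrite -natr1 mulrDl mul1r; lra.
rewrite /N; move: gain; set q := 2 * s ^+ 4 / _ => gain.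
set x1 := cmod (l + s%:C%C) ^+ 2 in sq *; set x2 := cmod (l - s%:C%C) ^+ 2 in sq *.
set x3 := cmod (l + ('i * s%:C)%C) ^+ 2 in sq *.
set x4 := cmod (l - ('i * s%:C)%C) ^+ 2 in sq *.
set mm := Num.max 0 (2 / d - n.+1%:R * k) in mk *.
set W := (L + s) ^+ 2; set y := cmod l ^+ 2 in sq *.
have -> : (eta + eps * (W - x1) + m + (eta + eps * (W - x2) + m) +
   (eta + eps * (W - x3) + m) + (eta + eps * (W - x4) + m)) / 4 =
   eta + m + eps * (W - (x1 + x2 + x3 + x4) / 4) by field.
rewrite sq (_ : (4 * y + 4 * s ^+ 2) / 4 = y + s ^+ 2); last by field.
rewrite opprD addrA mulrBr; lra.
Qed.

(** A discrete Liouville argument: the distance from the cut resolvent to the polynomials is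
    subharmonic in [l], bounded, and small at infinity, hence small everywhere. Multiplying an
    approximation of [1_P / (u - l)] by [X - l] gives one of [1_P]. *)
Lemma runge_indicator P P' (e : R) : separated_cover P P' -> 0 < e ->
  exists Q : {poly C}, (forall u, P u -> cmod (Q.[u] - 1) <= e) /\
                       (forall u, P' u -> cmod Q.[u] <= e).
Proof.
move=> cov e0; have dp := d0.
have [b nB0 nB] : exists2 b : R, 0 <= b & B <= b.
  by exists `|B|; [exact: normr_ge0|exact: ler_norm].
(* [D] bounds [|u - l|] on [S] for the [l] chosen below; it will multiply three errors [eta]. *)
pose D : R := b * 2 + d; have D0 : 0 < D by rewrite /D; lra.
pose eta : R := e / (4 * D); have eta0 : 0 < eta by rewrite /eta divr_gt0// mulr_gt0.
have ie : 0 < eta^-1 by rewrite invr_gt0.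
pose L : R := b + eta^-1 + d; have L0 : 0 < L by rewrite /L; lra.
pose eps : R := eta / (L + d) ^+ 2.
have Ld : 0 < (L + d) ^+ 2 by rewrite exprn_gt0//; lra.
have eps0 : 0 < eps by rewrite /eps divr_gt0.
have d5 : 0 < d ^+ 5 by rewrite exprn_gt0.
(* The bounds on [s] make the mean value error [64 s^4 / d^5] at most half of the gain [eps s^2];
   the other half pays [k] twice, once as [e] and once as the decrease per step. *)
pose s : R := Num.min (d / 4) (Num.min 1 (eps * d ^+ 5 / 128)).
have s0 : 0 < s by rewrite /s !lt_min ltr01 !divr_gt0// mulr_gt0.
have sd : s <= d / 4 by rewrite /s ge_min lexx.
have s1 : s <= 1 by rewrite /s !ge_min lexx !orbT.
have se : s <= eps * d ^+ 5 / 128 by rewrite /s !ge_min lexx !orbT.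
pose k : R := eps * s ^+ 2 / 4.
have k0 : 0 < k by rewrite /k divr_gt0// mulr_gt0// exprn_gt0.
have gain : k + k + 2 * s ^+ 4 / (d / 2) ^+ 5 <= eps * s ^+ 2.
  have -> : 2 * s ^+ 4 / (d / 2) ^+ 5 = s ^+ 2 * (64 * s ^+ 2 / d ^+ 5) by field; rewrite gt_eqF.
  have : 64 * s ^+ 2 / d ^+ 5 <= eps / 2.
    rewrite ler_pdivrMr//; have : s ^+ 2 <= s by rewrite expr2 ler_piMl// ltW.
    lra.
  have s2 : 0 <= s ^+ 2 by rewrite sqr_ge0.
  by move=> /(ler_wpM2l s2); rewrite /k; lra.
have [n nk] : exists n, 2 / d <= n%:R * k.
  exists (Num.truncn (2 / d / k)).+1; rewrite -ler_pdivrMr// ltW//.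
  exact: truncnS_gt.
pose l : C := ((b + d)%:C)%C.
have cl : cmod l = b + d by rewrite cmod_real ger0_norm//; lra.
have lL : cmod l <= L + s by rewrite cl /L; lra.
have := resolvent_descent cov s0 sd k0 eps0 eta0 (ltW k0) gain _ _ n lL.
rewrite (_ : Num.max 0 _ = 0); last by apply/max_idPl; lra.
move=> /(_ _ _)/[!addr0] ap.
have farP : far P l d.
  move=> x Px; rewrite cmodC; have := cmod_lerB l x.
  have := SB (proj2 (proj1 cov x) (or_introl Px)); lra.
have {}ap : resolvent_appr P P' l (eta + eta).
  have Le : eta + eps * ((L + s) ^+ 2 - cmod l ^+ 2) <= eta + eta.
    rewrite lerD2l (_ : eta = eps * (L + d) ^+ 2); last by rewrite /eps divfK ?gt_eqF.
    rewrite ler_pM2l//; have := sqr_ge0 (cmod l).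
    have : (L + s) ^+ 2 <= (L + d) ^+ 2 by apply: lerXn2r; rewrite ?nnegrE; lra.
    lra.
  have BL : B + eta^-1 <= L by rewrite /L; lra.
  have BdL : B + d <= L by rewrite /L; lra.
  by have [[? /(poly_appr_le Le)]|[? /(poly_appr_le Le)]] := ap BL BdL; [left|right].
have [a aP] := resolvent_apprP cov d0 eta0 farP ap.
have Dl u : S u -> cmod (u - l) <= D.
  by move=> /SB; have := cmodB u l; rewrite cl /D; lra.
have De : D * (eta + eta + eta) <= e.
  have -> : e = D * (4 * eta) by rewrite /eta; field; rewrite gt_eqF.
  by rewrite ler_pM2l//; lra.
have e3 : 0 <= eta + eta + eta by lra.
exists (('X - l%:P) * a); split=> u Pu.
  have Su : S u by apply/(proj1 cov); left.
  have ul : u - l != 0 by rewrite -cmod_gt0 (lt_le_trans d0)// farP.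
  apply: le_trans De; rewrite hornerM hornerXsubC.
  have := aP _ Su; rewrite /indic_inv; case: pselect => [?|//] le.
  rewrite (_ : _ - 1 = - ((u - l) * ((u - l)^-1 - a.[u]))); last first.
    by rewrite mulrBr mulfV//; ring.
  by rewrite cmodN cmodM ler_pM ?cmod_ge0// Dl.
have Su : S u by apply/(proj1 cov); right.
apply: le_trans De; rewrite hornerM hornerXsubC.
have := aP _ Su; rewrite /indic_inv; case: pselect => [Pu'|?].
  by have := proj2 cov _ _ Pu' Pu; rewrite subrr cmod0 leNgt d0.
by rewrite sub0r cmodN => le; rewrite cmodM ler_pM ?cmod_ge0// Dl.
Qed.

End Separation.

End Runge.

(** * The sides of a regular zero set *)

Section LocallyConstant.

Lemma connected_locally_constant (T : topologicalType) (A : set T) (D : T -> Prop) :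
  connected A -> (forall x, A x -> \forall y \near x, A y -> (D y <-> D x)) ->
  forall x y, A x -> A y -> D x -> D y.
Proof.
move=> cA Dloc x y Ax Ay Dx.
have BA : A `&` D = A; last by have : A y by []; rewrite -[in X in X -> _]BA => -[].
apply: cA; first by exists x.
  exists (interior [set z | A z -> D z]); first exact: open_interior.
  apply/seteqP; split=> [z [Az Dz]|z [Az /interior_subset]]; last by split => //; auto.
  split => //; apply: filterS (Dloc z Az) => w Dw Aw; exact/(Dw Aw).
exists (~` interior [set z | A z -> ~ D z]); first exact/open_closedC/open_interior.
apply/seteqP; split=> [z [Az Dz]|z [Az nz]].
  by split => // /interior_subset /(_ Az).
split => //; apply: contrapT => nDz; apply: nz.
by apply: filterS (Dloc z Az) => w Dw Aw /(Dw Aw).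
Qed.

Variable R : realType.

Lemma segment_locally_constant (D : R * R -> Prop) (x y : R * R) :
  (forall t : R, 0 <= t <= 1 ->
     \forall z \near (x + t *: (y - x)), D z <-> D (x + t *: (y - x))) ->
  D x <-> D y.
Proof.
move=> Dloc; pose E (t : R) := D (x + t *: (y - x)).
have Eloc (t : R) : `[(0:R), 1]%classic t ->
    \forall s \near t, `[(0:R), 1]%classic s -> (E s <-> E t).
  rewrite /= in_itv /= => /Dloc Dt.
  have : (fun s : R => x + s *: (y - x)) @ t --> x + t *: (y - x).
    by apply: cvgD; [exact: cvg_cst|exact: scalel_continuous].
  move=> /(_ _ Dt) Dt'; near=> s => _.
  by near: s; exact: Dt'.
have I0 : `[0, 1]%classic (0 : R) by rewrite /= in_itv /= lexx ler01.
have I1 : `[0, 1]%classic (1 : R) by rewrite /= in_itv /= lexx ler01.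
have c01 := @segment_connected R 0 1.
have E0 : E 0 = D x by rewrite /E scale0r addr0.
have E1 : E 1 = D y by rewrite /E scale1r addrC subrK.
rewrite -E0 -E1; split; exact: (connected_locally_constant c01 Eloc).
Unshelve. all: by end_near. Qed.

End LocallyConstant.

Section RegularZero.
Variable R : realType.
Implicit Types (h : R * R -> R) (p x y z G : R * R).

Definition dot G x : R := G.1 * x.1 + G.2 * x.2.

(* The first-order expansion holds with a Lipschitz error in the gradient,
   uniformly in both end points. *)
Definition regular_zero h p := exists G (C r0 : R),
  [/\ 0 < r0, 0 <= C, 0 < cmod (toC G), h p = 0 &
   forall (r : R) y z, r <= r0 -> cmod (toC (y - p)) <= r -> cmod (toC (z - p)) <= r ->
     `|h z - h y - dot G (z - y)| <= C * r * cmod (toC (z - y))].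

Lemma regular_zeroN h p : regular_zero h p -> regular_zero (fun x => - h x) p.
Proof.
move=> [G [C [r0 [r00 C0 G0 hp E]]]]; exists (- G), C, r0; split => //.
- by rewrite (_ : toC (- G) = - toC G) ?cmodN.
- by rewrite hp oppr0.
move=> r y z rr0 yp zp; have := E _ _ _ rr0 yp zp.
suff -> : - h z - - h y - dot (- G) (z - y) = - (h z - h y - dot G (z - y)).
  by rewrite normrN.
by rewrite /dot /=; ring.
Qed.

(** * Regular zeros from smoothness *)

Lemma directional_mvt (F : R * R -> R) (v x : R * R) (a : R) :
  (forall y, derivable F y v) ->
  exists2 c : R, `|c| <= `|a| & F (x + a *: v) - F x = a * 'D_v F (x + c *: v).
Proof.
move=> dF; pose g (t : R) := F (x + t *: v).
have dg (t : R) : is_derive t 1 g ('D_v F (x + t *: v)).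
  have E : (fun h : R => h^-1 *: ((g \o shift t) (h *: 1) - g t)) =
           (fun h : R => h^-1 *: ((F \o shift (x + t *: v)) (h *: v) - F (x + t *: v))).
    apply/funext => h; rewrite /g /=; congr (_ *: (F _ - _)).
    by rewrite (_ : h *: (1 : R) = h) ?scalerDl ?(addrCA x)//; exact: mulr1.
  split; first by rewrite /derivable E; exact: dF.
  by rewrite /derive E.
have cg A : {within A, continuous g}.
  apply: continuous_subspaceT => t; apply/differentiable_continuous/derivable1_diffP.
  by have [] := dg t.
have [a0|/ltW a0] := leP 0 a.
  have [c] := MVT_segment a0 (fun t _ => dg t) (cg _).
  rewrite in_itv /= => /andP[c0 ca] E; exists c; first by rewrite !ger0_norm.
  by move: E; rewrite /g scale0r addr0 subr0 mulrC.
have [c] := MVT_segment a0 (fun t _ => dg t) (cg _).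
rewrite in_itv /= => /andP[ca c0] E; exists c; first by rewrite !ler0_norm// lerN2.
move: E; rewrite /g scale0r addr0 sub0r => E.
by apply: oppr_inj; rewrite opprB E; ring.
Qed.

Lemma mvt_plane (F : R * R -> R) (y z : R * R) :
  (forall x v, derivable F x v) ->
  exists c1 c2 : R, [/\ `|c1| <= `|z.1 - y.1|, `|c2| <= `|z.2 - y.2| &
   F z - F y = (z.1 - y.1) * 'D_((1, 0) : R * R) F (y.1 + c1, z.2)
             + (z.2 - y.2) * 'D_((0, 1) : R * R) F (y.1, y.2 + c2)].
Proof.
move=> dF.
have [c1 c1P E1] := directional_mvt (y.1, z.2) (z.1 - y.1) (fun x => dF x (1, 0)).
have [c2 c2P E2] := directional_mvt y (z.2 - y.2) (fun x => dF x (0, 1)).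
exists c1, c2; split => //.
have e1 (t u w : R) : (t, u) + w *: ((1, 0) : R * R) = (t + w, u).
  by congr pair; rewrite /= /GRing.scale /= ?mulr1 ?mulr0 ?addr0.
have e2 (t : R * R) (w : R) : t + w *: ((0, 1) : R * R) = (t.1, t.2 + w).
  by congr pair; rewrite /= /GRing.scale /= ?mulr1 ?mulr0 ?addr0.
rewrite !e1 in E1; rewrite !e2 in E2.
rewrite (_ : y.1 + (z.1 - y.1) = z.1) in E1; last by ring.
rewrite (_ : y.2 + (z.2 - y.2) = z.2) in E2; last by ring.
rewrite -E1 -E2; case: (z) (y) => [z1 z2] [y1 y2] /=; ring.
Qed.

Local Notation e1 := ((1, 0) : R * R).
Local Notation e2 := ((0, 1) : R * R).

Lemma locally_lipschitz (F : R * R -> R) p :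
  (forall x v, derivable F x v) -> continuous ('D_e1 F) -> continuous ('D_e2 F) ->
  exists M r0 : R, [/\ 0 <= M, 0 < r0 & forall r q, r <= r0 ->
    `|q.1 - p.1| <= r -> `|q.2 - p.2| <= r -> `|F q - F p| <= M * r].
Proof.
move=> dF c1 c2.
have bnd (G : R * R -> R) : continuous G ->
    exists2 d : R, 0 < d & forall y, cmod (toC (y - p)) < d -> `|G y| <= `|G p| + 1.
  move=> /(_ p) /cvgrPdist_lt /(_ 1 ltr01) /near_cmodP[d d0 dP]; exists d => // y /dP.
  have := ler_normD (G y - G p) (G p); rewrite subrK (distrC (G p)); lra.
have [d1 d10 b1] := bnd _ c1; have [d2 d20 b2] := bnd _ c2.
exists (`|'D_e1 F p| + 1 + (`|'D_e2 F p| + 1)), (Num.min d1 d2 / 4).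
have m0 : 0 < Num.min d1 d2 by rewrite lt_min d10 d20.
split; [by rewrite !addr_ge0|by rewrite divr_gt0|].
move=> r q rd q1 q2.
have [a [b [a1 b2' ->]]] := mvt_plane p q dF.
have r0 : 0 <= r by apply: le_trans q1.
have lt1 : Num.min d1 d2 <= d1 by rewrite ge_min lexx.
have lt2 : Num.min d1 d2 <= d2 by rewrite ge_min lexx orbT.
apply: le_trans (ler_normD _ _) _; rewrite !normrM mulrDl.
have n1 : `|'D_e1 F (p.1 + a, q.2)| <= `|'D_e1 F p| + 1.
  by apply: b1; apply: le_lt_trans (cmod_le_sum _) _; rewrite /= [p.1 + a]addrC addrK; lra.
have n2 : `|'D_e2 F (p.1, p.2 + b)| <= `|'D_e2 F p| + 1.
  apply: b2; apply: le_lt_trans (cmod_le_sum _) _.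
  by rewrite /= [p.2 + b]addrC addrK subrr normr0; lra.
by rewrite lerD// mulrC ler_pM.
Qed.

(** The partial derivatives are locally Lipschitz because their own partials are continuous; this
    gives the uniform expansion. Were [G] zero, the expansion at [p] would be quadratic, and
    uniqueness of the differential would force ['d h p = 0]. *)
Lemma smooth_regular_zero h p : smooth2 h -> h p = 0 ->
  (exists v, 'd h p v != 0) -> regular_zero h p.
Proof.
move=> sm hp [v hv].
have dh : forall x v, derivable h x v by move=> x w; have [_] := sm [::]; exact.
have dd u : forall x v, derivable ('D_u h) x v.
  by move=> x w; have [_] := sm [:: u]; exact.
have cc u w : continuous ('D_w ('D_u h)) by have [] := sm [:: w; u].
have [M1 [d1 [M10 d10 L1]]] := locally_lipschitz p (dd e1) (cc e1 e1) (cc e1 e2).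
have [M2 [d2 [M20 d20 L2]]] := locally_lipschitz p (dd e2) (cc e2 e1) (cc e2 e2).
pose G : R * R := ('D_e1 h p, 'D_e2 h p).
(* The intermediate points of [mvt_plane] stay within [3 r] of [p] in each coordinate, whence both
   factors 3. *)
pose C : R := 3 * (M1 + M2); pose r0 : R := Num.min d1 d2 / 3.
have m0 : 0 < Num.min d1 d2 by rewrite lt_min d10 d20.
have C0 : 0 <= C by rewrite /C; lra.
have r00 : 0 < r0 by rewrite divr_gt0.
have E (r : R) y z : r <= r0 -> cmod (toC (y - p)) <= r -> cmod (toC (z - p)) <= r ->
     `|h z - h y - dot G (z - y)| <= C * r * cmod (toC (z - y)).
  move=> rr0 yp zp.
  have [a [b [a1 b1 ->]]] := mvt_plane y z dh.
  have -> : (z.1 - y.1) * 'D_e1 h (y.1 + a, z.2) + (z.2 - y.2) * 'D_e2 h (y.1, y.2 + b) -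
     dot G (z - y) = (z.1 - y.1) * ('D_e1 h (y.1 + a, z.2) - 'D_e1 h p) +
     (z.2 - y.2) * ('D_e2 h (y.1, y.2 + b) - 'D_e2 h p).
    by rewrite /dot /=; ring.
  have lt1 : Num.min d1 d2 <= d1 by rewrite ge_min lexx.
  have lt2 : Num.min d1 d2 <= d2 by rewrite ge_min lexx orbT.
  have y1 : `|y.1 - p.1| <= r by exact: le_trans (cmod_fst (y - p)) yp.
  have y2 : `|y.2 - p.2| <= r by exact: le_trans (cmod_snd (y - p)) yp.
  have z1 : `|z.1 - p.1| <= r by exact: le_trans (cmod_fst (z - p)) zp.
  have z2 : `|z.2 - p.2| <= r by exact: le_trans (cmod_snd (z - p)) zp.
  have a3 : `|y.1 + a - p.1| <= 3 * r.
    have := ler_normD (y.1 - p.1) a; have := ler_normB (z.1 - p.1) (y.1 - p.1).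
    rewrite (_ : z.1 - p.1 - (y.1 - p.1) = z.1 - y.1); last by ring.
    by rewrite (_ : y.1 - p.1 + a = y.1 + a - p.1); [lra|ring].
  have b3 : `|y.2 + b - p.2| <= 3 * r.
    have := ler_normD (y.2 - p.2) b; have := ler_normB (z.2 - p.2) (y.2 - p.2).
    rewrite (_ : z.2 - p.2 - (y.2 - p.2) = z.2 - y.2); last by ring.
    by rewrite (_ : y.2 - p.2 + b = y.2 + b - p.2); [lra|ring].
  have r30 : 3 * r <= d1 by move: rr0; rewrite /r0; lra.
  have r31 : 3 * r <= d2 by move: rr0; rewrite /r0; lra.
  have rp : 0 <= r by exact: le_trans z1.
  have K1 : `|'D_e1 h (y.1 + a, z.2) - 'D_e1 h p| <= M1 * (3 * r).
    by apply: L1 => //=; lra.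
  have K2 : `|'D_e2 h (y.1, y.2 + b) - 'D_e2 h p| <= M2 * (3 * r).
    by apply: L2 => //=; lra.
  apply: le_trans (ler_normD _ _) _; rewrite !normrM.
  apply: (@le_trans _ _ (cmod (toC (z - y)) * (M1 * (3 * r)) +
    cmod (toC (z - y)) * (M2 * (3 * r)))).
    by rewrite lerD// ler_pM//; [exact: (cmod_fst (z - y))|exact: (cmod_snd (z - y))].
  by rewrite /C le_eqVlt; apply/orP; left; apply/eqP; ring.
exists G, C, r0; split => //.
rewrite cmod_gt0; apply: contra_neq hv => G0.
have G00 : G = 0 by apply: toC_inj; rewrite G0.
suff -> : 'd h p = (\0 : {linear (R * R)%type -> R}) :> (R * R -> R) by [].
apply: diff_unique; first exact: cst_continuous.
apply/eqaddoP => _/posnumP[eps].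
have : \forall x \near (0 : R * R), cmod (toC (x - 0)) < Num.min r0 (eps%:num / (2 * (C + 1))).
  apply/near_cmodP; exists (Num.min r0 (eps%:num / (2 * (C + 1)))) => //.
  by rewrite lt_min r00 divr_gt0// mulr_gt0//; lra.
apply: filterS => x; rewrite subr0 lt_min => /andP[xr xe].
have := E (cmod (toC x)) p (p + x) (ltW xr); rewrite subrr addrAC subrr add0r.
rewrite (_ : toC 0 = 0)// cmod0 cmod_ge0 lexx => /(_ isT isT).
rewrite /dot G00 /= !mul0r addr0 subr0 (addrC p) => le.
rewrite (_ : (h \o shift p - (cst (h p) + \0)) x = h (x + p) - h p); last first.
  by congr (_ - _); exact: addr0.
apply: le_trans le _.
have xn : cmod (toC x) <= 2 * `|x|.
  apply: le_trans (cmod_le_sum x) _.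
  have h1 : `|x.1| <= `|x| by rewrite prod_normE le_max lexx.
  have h2 : `|x.2| <= `|x| by rewrite prod_normE le_max lexx orbT.
  by rewrite mulrDl mul1r lerD.
have ce : C * cmod (toC x) <= eps%:num / 2.
  apply: (@le_trans _ _ ((C + 1) * (eps%:num / (2 * (C + 1))))).
    by apply: ler_pM; rewrite ?cmod_ge0 ?(ltW xe)//; lra.
  by rewrite le_eqVlt; apply/orP; left; apply/eqP; field; rewrite gt_eqF//; lra.
apply: (@le_trans _ _ (eps%:num / 2 * (2 * `|x|))).
  have c0 : 0 <= cmod (toC x) by exact: cmod_ge0.
  exact: (ler_pM (mulr_ge0 C0 c0) c0 ce xn).
by rewrite mulrA divfK.
Qed.

(** * Local geometry of the two sides *)

Lemma cmod_scale (t : R) x : cmod (toC (t *: x)) = `|t| * cmod (toC x).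
Proof.
rewrite -(cmod_real t) -cmodM; congr cmod; case: x => a b /=.
by rewrite /toC /= mulrC /GRing.scale /=; simpc; rewrite ![_ * t]mulrC.
Qed.

Lemma dotxx G : dot G G = cmod (toC G) ^+ 2.
Proof. by rewrite cmod_sqr /dot !expr2. Qed.

Lemma dotD G x y : dot G (x + y) = dot G x + dot G y.
Proof. by rewrite /dot /=; ring. Qed.

Lemma dotZ G (t : R) x : dot G (t *: x) = t * dot G x.
Proof. by rewrite /dot /= /GRing.scale /=; ring. Qed.

Lemma dot_le G x : `|dot G x| <= cmod (toC G) * cmod (toC x).
Proof.
rewrite -(@ler_pXn2r _ 2)// ?nnegrE ?mulr_ge0 ?cmod_ge0// exprMn !cmod_sqr.
rewrite real_normK ?num_real// /dot.
have := sqr_ge0 (G.1 * x.2 - G.2 * x.1); rewrite -subr_ge0 => H.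
by rewrite -subr_ge0; apply: le_trans H _; rewrite le_eqVlt; apply/orP; left; apply/eqP; ring.
Qed.

Lemma small_pos (a b : R) : 0 < a -> 0 <= b -> exists2 s : R, 0 < s & s * b < a.
Proof.
move=> a0 b0; exists (a / (b + 1)); first by rewrite divr_gt0//; lra.
by rewrite mulrAC ltr_pdivrMr ?ltr_pM2l//; lra.
Qed.

Lemma small_pos3 (a a' a'' b b' b'' : R) :
  0 < a -> 0 <= b -> 0 < a' -> 0 <= b' -> 0 < a'' -> 0 <= b'' ->
  exists s : R, [/\ 0 < s, s * b < a, s * b' < a' & s * b'' < a''].
Proof.
move=> a0 b0 a0' b0' a0'' b0''.
have [s s0 sb] := small_pos a0 b0; have [t t0 tb] := small_pos a0' b0'.
have [u u0 ub] := small_pos a0'' b0''.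
have m0 : 0 < Num.min s (Num.min t u) by rewrite !lt_min s0 t0.
exists (Num.min s (Num.min t u)); split => //.
- by apply: le_lt_trans sb; rewrite ler_wpM2r// ge_min lexx.
- by apply: le_lt_trans tb; rewrite ler_wpM2r// !ge_min lexx orbT.
- by apply: le_lt_trans ub; rewrite ler_wpM2r// !ge_min lexx !orbT.
Qed.

(** With [v = y - p] and [l = p - s G], a zero [y] near [p] satisfies [|G . v| <= C |v|^2], so
    [|y - l|^2 >= (1 - 2 s C) |v|^2 + (s g)^2]: for [2 s C < 1] the closed disc about [l] through
    [p] contains no other zero near [p]. Beyond [r0] the triangle inequality suffices. *)
Lemma regular_zero_exterior_disc h p (e : R) : regular_zero h p -> 0 < e ->
  exists l, [/\ cmod (toC (l - p)) < e, h l < 0 &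
    forall y, h y = 0 -> y != p -> cmod (toC (p - l)) < cmod (toC (y - l))].
Proof.
move=> [G [C [r0 [r00 C0 G0 hp E]]]] e0.
set g := cmod (toC G) in G0 *; have g0 := ltW G0.
have er : 0 < Num.min e (r0 / 2) by rewrite lt_min e0 divr_gt0.
have [s [s0 s1 s2 _]] := small_pos3 er g0 ltr01 (mulr_ge0 (ler0n R 2) C0) ltr01 ler01.
have sg0 : 0 < s * g by rewrite mulr_gt0.
move: s1; rewrite lt_min => /andP[se sr].
pose l := p - s *: G; have lp : l - p = (- s) *: G by rewrite /l addrC addKr scaleNr.
have clp : cmod (toC (l - p)) = s * g by rewrite lp cmod_scale normrN gtr0_norm.
exists l; split; first by rewrite clp.
  have sgr : s * g <= r0 by lra.
  have := E (s * g) p l sgr; rewrite subrr (_ : toC 0 = 0)// cmod0 clp lexx (ltW sg0).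
  move=> /(_ isT isT); rewrite lp dotZ dotxx -/g hp subr0 ler_norml => /andP[_].
  have : C * (s * g) * (s * g) < s * g ^+ 2.
    have -> : C * (s * g) * (s * g) = s * g ^+ 2 * (s * C) by ring.
    have sg2 : 0 < s * g ^+ 2 by rewrite mulr_gt0// exprn_gt0.
    by rewrite -[ltRHS]mulr1 ltr_pM2l//; lra.
  lra.
move=> y hy yp; rewrite -(cmodN (toC (p - l))) -(_ : toC (l - p) = - toC (p - l)); last first.
  by rewrite -opprB.
rewrite clp; set v := y - p; set c := cmod (toC v).
have yl : y - l = v + s *: G by rewrite /v /l opprB addrA addrAC.
have c0 : 0 < c by rewrite /c cmod_gt0; apply: contra_neq yp => /(@toC_inj _ v 0) /subr0_eq.
have [cr|rc] := leP c r0.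
  have := E c p y cr; rewrite subrr (_ : toC 0 = 0)// cmod0 (ltW c0) lexx.
  move=> /(_ isT isT); rewrite hy hp subrr sub0r normrN -/v -/c ler_norml => /andP[dv _].
  have Q : cmod (toC (y - l)) ^+ 2 = c ^+ 2 + 2 * s * dot G v + (s * g) ^+ 2.
    by rewrite yl /c /g exprMn !cmod_sqr /dot /= /GRing.scale /=; ring.
  rewrite -(@ltr_pXn2r _ 2)// ?nnegrE ?cmod_ge0// ?(ltW sg0)// Q.
  have : 2 * s * (- (C * c * c)) <= 2 * s * dot G v by rewrite ler_pM2l// mulr_gt0.
  have : 0 < c ^+ 2 * (1 - s * (2 * C)) by rewrite mulr_gt0 ?exprn_gt0//; lra.
  have -> : c ^+ 2 * (1 - s * (2 * C)) = c ^+ 2 + 2 * s * (- (C * c * c)) by ring.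
  lra.
rewrite yl; have := cmod_lerB (toC v) (- toC (s *: G)).
rewrite opprK cmodN cmod_scale gtr0_norm// -/g -/c -toCD; lra.
Qed.

Lemma regular_zero_increasing h p : regular_zero h p ->
  exists G, exists2 r : R, 0 < r & 0 < cmod (toC G) /\ forall y t, 0 < t ->
    cmod (toC (y - p)) <= r -> cmod (toC (y + t *: G - p)) <= r -> h y < h (y + t *: G).
Proof.
move=> [G [C [r0 [r00 C0 G0 hp E]]]]; exists G.
set g := cmod (toC G) in G0 *.
have [s [s0 s1 s2 _]] := small_pos3 G0 C0 r00 ler01 ltr01 ler01.
exists s => //; split => // y t t0 yp yt.
have sr : s <= r0 by lra.
have := E _ _ _ sr yp yt.
rewrite (_ : y + t *: G - y = t *: G) ?dotZ ?dotxx -/g; last by rewrite addrC addKr.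
rewrite cmod_scale (gtr0_norm t0) -/g.
rewrite ler_norml => /andP[+ _].
have : C * s * (t * g) < t * g ^+ 2.
  have -> : C * s * (t * g) = t * g * (s * C) by ring.
  by have -> : t * g ^+ 2 = t * g * g; [ring|rewrite ltr_pM2l ?mulr_gt0].
lra.
Qed.

Lemma regular_zero_side h p (e : R) : regular_zero h p -> 0 < e ->
  exists2 x, cmod (toC (x - p)) < e & 0 < h x.
Proof.
move=> rz e0; have hp : h p = 0 by case: rz => ? [? [? []]].
have [G [r r0 [G0 up]]] := regular_zero_increasing rz.
have er : 0 < Num.min e r by rewrite lt_min e0.
have [s s0] := small_pos er (ltW G0); rewrite lt_min => /andP[se sr].
have k : cmod (toC (p + s *: G - p)) = s * cmod (toC G).
  by rewrite [p + _]addrC addrK cmod_scale gtr0_norm.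
exists (p + s *: G); first by rewrite k.
rewrite -hp; apply: up => //; last by rewrite k ltW.
by rewrite subrr (_ : toC 0 = 0)// cmod0 ltW.
Qed.

Lemma regular_zero_dense_side h p : regular_zero h p ->
  exists2 r : R, 0 < r & forall y (e : R), cmod (toC (y - p)) < r -> h y = 0 -> 0 < e ->
    exists2 x, cmod (toC (x - y)) < e & 0 < h x.
Proof.
move=> rz; have [G [r r0 [G0 up]]] := regular_zero_increasing rz.
exists r => // y e yr hy e0.
have er : 0 < Num.min e (r - cmod (toC (y - p))) by rewrite lt_min e0 subr_gt0.
have [s s0] := small_pos er (ltW G0); rewrite lt_min => /andP[se sr].
have k : cmod (toC (y + s *: G - y)) = s * cmod (toC G).
  by rewrite [y + _]addrC addrK cmod_scale gtr0_norm.
exists (y + s *: G); first by rewrite k.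
rewrite -hy; apply: up => //; first exact: ltW.
have := cmod_tri (toC y) (toC (y + s *: G)) (toC p); rewrite -!toCB k; lra.
Qed.

(** Connectedness of the positive side near [p], phrased for locally constant predicates. Every
    point slides up by [T G], along which [h] increases, then moves straight to the common point
    [p + T G]. The segments may leave the ball of radius [r], hence the two radii. *)
Lemma regular_zero_side_connected h p (e : R) : regular_zero h p -> 0 < e ->
  exists r : R, [/\ 0 < r, r <= e & forall D : R * R -> Prop,
    (forall x, cmod (toC (x - p)) < e -> 0 < h x -> \forall y \near x, D y <-> D x) ->
    forall x y, cmod (toC (x - p)) < r -> cmod (toC (y - p)) < r ->
      0 < h x -> 0 < h y -> (D x <-> D y)].
Proof.
move=> [G [C [r0 [r00 C0 G0 hp E]]]] e0.
set g := cmod (toC G) in G0 *.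
have m0 : 0 < Num.min e r0 by rewrite lt_min e0.
have [r [rp r1 r2 _]] := small_pos3 m0 (ler0n R 3) G0 (mulr_ge0 (ler0n R 9) C0) ltr01 ler01.
move: r1; rewrite lt_min => /andP[re rr0].
exists r; split=> [//||D Dloc]; first lra.
(* Since [T g = 2 r], the linear term of [h] is at least [r g] on the second segment, more than the
   error [9 C r^2]. *)
pose T := 2 * r / g; have T0 : 0 < T by rewrite divr_gt0// mulr_gt0.
have Tg : T * g = 2 * r by rewrite /T divfK// gt_eqF.
have cT : cmod (toC (T *: G)) = 2 * r by rewrite cmod_scale gtr0_norm.
pose b := p + T *: G.
have toB x : cmod (toC (x - p)) < r -> 0 < h x -> (D x <-> D b).
  move=> xr hx; pose x' := x + T *: G.
  have step (t : R) : 0 <= t <= 1 -> cmod (toC (x + (t * T) *: G - p)) <= 3 * r.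
    move=> /andP[t0 t1]; rewrite addrAC toCD.
    apply: le_trans (cmodD _ _) _; rewrite -scalerA cmod_scale cT ger0_norm//.
    have : t * (2 * r) <= 1 * (2 * r) by rewrite ler_wpM2r//; lra.
    lra.
  have xx' : D x <-> D x'.
    apply: segment_locally_constant => t t01; rewrite /x' [x + _ - x]addrC addKr scalerA.
    apply: Dloc; first by apply: le_lt_trans (step _ t01) _; lra.
    have r3 : 3 * r <= r0 by lra.
    have xp3 : cmod (toC (x - p)) <= 3 * r by lra.
    have := E _ _ _ r3 xp3 (step _ t01).
    case/andP: t01 => t0 t1; have tT : 0 <= t * T by rewrite mulr_ge0// ltW.
    set u := x + _; have -> : u - x = (t * T) *: G by rewrite /u addrC addKr.
    rewrite dotZ dotxx -/g cmod_scale (ger0_norm tT) -/g.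
    rewrite ler_norml => /andP[+ _].
    have : C * (3 * r) * (t * T * g) <= t * T * g ^+ 2.
      have -> : C * (3 * r) * (t * T * g) = t * T * g * (r * (3 * C)) by ring.
      have -> : t * T * g ^+ 2 = t * T * g * g by ring.
      apply: ler_wpM2l; first by rewrite mulr_ge0// ltW.
      have : 0 <= r * C by rewrite mulr_ge0// ltW.
      lra.
    lra.
  rewrite xx'; apply: segment_locally_constant => t /andP[t0 t1].
  set z := x' + _.
  have zp : z - p = T *: G + (1 - t) *: (x - p).
    rewrite /z /x' /b; case: (x) (p) (G) => [? ?] [? ?] [? ?].
    by congr pair; rewrite /= /GRing.scale /=; ring.
  have xr' : cmod (toC ((1 - t) *: (x - p))) <= r.
    rewrite cmod_scale ger0_norm; last lra.
    have : (1 - t) * cmod (toC (x - p)) <= 1 * cmod (toC (x - p)).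
      by rewrite ler_wpM2r ?cmod_ge0//; lra.
    lra.
  have z3 : cmod (toC (z - p)) <= 3 * r.
    by rewrite zp toCD; apply: le_trans (cmodD _ _) _; rewrite cT; lra.
  apply: Dloc; first lra.
  have r3 : 3 * r <= r0 by lra.
  have p0 : cmod (toC (p - p)) <= 3 * r by rewrite subrr (_ : toC 0 = 0)// cmod0; lra.
  have := E _ _ _ r3 p0 z3; rewrite hp subr0 ler_norml => /andP[+ _].
  have : C * (3 * r) * cmod (toC (z - p)) <= C * (3 * r) * (3 * r).
    by rewrite ler_wpM2l// mulr_ge0//; lra.
  rewrite zp dotD dotZ dotxx -/g.
  have := dot_le G ((1 - t) *: (x - p)); rewrite -/g ler_norml => /andP[+ _].
  have : g * cmod (toC ((1 - t) *: (x - p))) <= g * r by rewrite ler_wpM2l// ltW.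
  have : T * g ^+ 2 = g * (2 * r) by rewrite -Tg; ring.
  have : C * (3 * r) * (3 * r) < g * r.
    by rewrite (_ : C * (3 * r) * (3 * r) = r * (9 * C) * r) ?ltr_pM2r//; ring.
  lra.
by move=> x y xr yr hx hy; rewrite (toB _ xr hx) (toB _ yr hy).
Qed.

End RegularZero.

(** * Arguments on the frontier of a bounded open set *)

Section NoLogarithm.
Variable R : realType.
Implicit Types (x y : R * R) (t : R).

Definition circ t : R * R := (cos t, sin t).

Lemma circ_norm t : (circ t).1 ^+ 2 + (circ t).2 ^+ 2 = 1.
Proof. exact: cos2Dsin2. Qed.

Lemma cmod_circ t : cmod (toC (circ t)) = 1.
Proof.
have := cmod_sqr (circ t); rewrite circ_norm => /eqP; rewrite sqrf_eq1.
by case/orP => /eqP // E; have := cmod_ge0 (toC (circ t)); rewrite E; lra.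
Qed.

Lemma circ_continuous : continuous circ.
Proof. by move=> t; exact: (cvg_pair (@continuous_cos R t) (@continuous_sin R t)). Qed.

Lemma circDpi t : circ (t + pi) = - circ t.
Proof. by rewrite /circ cosDpi sinDpi. Qed.

Lemma circD2pi t : circ (t + pi *+ 2) = circ t.
Proof. by rewrite /circ cosD2pi sinD2pi. Qed.

Lemma circ_atan (re im : R) : 0 < re -> re ^+ 2 + im ^+ 2 = 1 ->
  circ (atan (im / re)) = (re, im).
Proof.
move=> re0 sq; have re_n0 : re != 0 by rewrite gt_eqF.
have cE : cos (atan (im / re)) = re.
  rewrite cos_atan expr_div_n (_ : 1 + im ^+ 2 / re ^+ 2 = re ^- 2); last first.
    by apply: (mulIf (expf_neq0 2 re_n0)); rewrite mulrDl mul1r divfK ?expf_neq0// mulVf ?expf_neq0.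
  by rewrite -exprVn sqrtr_sqr ger0_norm ?invrK// invr_ge0 ltW.
congr pair => //; have := @atanK _ (im / re); rewrite /tan cE => /(congr1 ( *%R^~ re)).
by rewrite !divfK.
Qed.

(** [re] and [im] are the coordinates of [x] turned by [-t]. A chord shorter than 1 gives
    [2 - 2 re < 1], so [re > 0] and the arctangent is the true angle. *)
Lemma close_circ (t : R) x : x.1 ^+ 2 + x.2 ^+ 2 = 1 ->
  cmod (toC (x - circ t)) < 1 ->
  let re := cos t * x.1 + sin t * x.2 in let im := cos t * x.2 - sin t * x.1 in
  0 < re /\ circ (t + atan (im / re)) = x.
Proof.
move=> x1 xt re im.
have ct := cos2Dsin2 t.
have : cmod (toC (x - circ t)) ^+ 2 < 1.
  by rewrite -[ltRHS](expr1n _ 2) ltr_pXn2r ?nnegrE ?cmod_ge0.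
rewrite cmod_sqr /=.
have -> : (x.1 - cos t) ^+ 2 + (x.2 - sin t) ^+ 2 =
  (x.1 ^+ 2 + x.2 ^+ 2) + (cos t ^+ 2 + sin t ^+ 2) - 2 * re by rewrite /re; ring.
rewrite x1 ct => re1; have re0 : 0 < re by lra.
split=> //; have sq : re ^+ 2 + im ^+ 2 = 1.
  have -> : re ^+ 2 + im ^+ 2 = (x.1 ^+ 2 + x.2 ^+ 2) * (cos t ^+ 2 + sin t ^+ 2).
    by rewrite /re /im; ring.
  by rewrite x1 ct mulr1.
have [cE sE] := circ_atan re0 sq.
rewrite /circ cosD sinD cE sE [in RHS](surjective_pairing x); congr pair.
  have -> : cos t * re - sin t * im = x.1 * (cos t ^+ 2 + sin t ^+ 2).
    by rewrite /re /im; ring.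
  by rewrite ct mulr1.
have -> : sin t * re + cos t * im = x.2 * (cos t ^+ 2 + sin t ^+ 2).
  by rewrite /re /im; ring.
by rewrite ct mulr1.
Qed.

(* Lifting the homotopy [s |-> g (l0 + s B e^(i t))] step by step gives a periodic
   angle function on the outer circle, which [g (l0 + B e^(i t)) = e^(i t)] forbids. *)
Lemma no_retraction (g : R * R -> R * R) (l0 : R * R) (B : R) :
  0 < B -> continuous g -> (forall x, (g x).1 ^+ 2 + (g x).2 ^+ 2 = 1) ->
  (exists t, g l0 = circ t) ->
  (forall t, g (l0 + B *: circ t) = circ t) -> False.
Proof.
move=> B0 cg g1 [t0 gt0] gB.
(* Uniform continuity on a square around the disc, with oscillation below the chord length 1 that
   [close_circ] requires. *)
have [d d0 dP] : exists2 d : R, 0 < d & forall x y,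
    cmod (toC (x - l0)) <= B -> cmod (toC (y - x)) < d -> cmod (toC (g y - g x)) < 1.
  pose Q : set (R * R) := `[l0.1 - B, l0.1 + B] `*` `[l0.2 - B, l0.2 + B].
  have cQ : compact Q by apply: compact_setX; exact: segment_compact.
  have /compact_near_coveringP cov := cQ.
  have near_d : \forall d \near 0^'+, Q `<=` fun x => forall y,
      cmod (toC (y - x)) < d -> cmod (toC (g y - g x)) < 1.
    apply: cov => x _.
    have := cg x; move=> /cvg_ballP /(_ (1/4)) /=.
    have q0 : (0 : R) < 1/4 by lra.
    move=> /(_ q0) /near_cmodP [r r0 rP].
    exists ([set y | cmod (toC (y - x)) < r / 2], [set d | d < r / 2]) => /=.
      split; first by apply/near_cmodP; exists (r / 2) => //; rewrite divr_gt0.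
      by apply: nbhs_right_lt; rewrite divr_gt0.
    move=> [y e] /= [yx er] z zy.
    have zx : cmod (toC (z - x)) < r.
      by have := cmod_tri (toC y) (toC z) (toC x); rewrite -!toCB; lra.
    have yx' : cmod (toC (y - x)) < r by lra.
    have [z1 z2] := rP _ zx; have [y1 y2] := rP _ yx'.
    move: z1 z2 y1 y2; rewrite /ball /= => z1 z2 y1 y2.
    apply: le_lt_trans (cmod_le_sum _) _ => /=.
    have := ler_distD (g x).1 (g z).1 (g y).1; have := ler_distD (g x).2 (g z).2 (g y).2.
    rewrite (distrC (g z).1 (g x).1) (distrC (g z).2 (g x).2); lra.
  have [d [dQ d0]] := @filter_ex _ _ _ _ (filterI near_d (nbhs_right_gt 0)).
  exists d => // x y xB; apply: dQ; split => /=.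
    by have := le_trans (cmod_fst _) xB; rewrite /= in_itv /= ler_norml; lra.
  by have := le_trans (cmod_snd _) xB; rewrite /= in_itv /= ler_norml; lra.
have [n nd] : exists n : nat, B < n%:R * d.
  exists (Num.truncn (B / d)).+1; rewrite -ltr_pdivrMr//; exact: truncnS_gt.
have n0 : (0 : R) < n%:R by case: (n) nd => [|m _]; rewrite ?ltr0n// mul0r ltNge (ltW B0).
pose H (i : nat) t := g (l0 + (i%:R * (B / n%:R)) *: circ t).
have lift i : (i <= n)%N -> exists A : R -> R,
    [/\ continuous A, A 0 = A (pi *+ 2) & forall t, H i t = circ (A t)].
  elim: i => [_|i IH iN].
    exists (fun=> t0); split => // [|t]; first exact: cst_continuous.
    by rewrite /H mul0r scale0r addr0.
  have [A [cA A2 HA]] := IH (ltnW iN).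
  have step t : cmod (toC (H i.+1 t - circ (A t))) < 1.
    rewrite -HA; apply: dP.
      rewrite addrC addKr cmod_scale cmod_circ mulr1 ger0_norm; last first.
        by rewrite mulr_ge0// divr_ge0// ltW.
      by rewrite mulrCA ler_piMr ?(ltW B0)// ler_pdivrMr// mul1r ler_nat ltnW.
    rewrite opprD addrACA subrr add0r -scalerBl -mulrBl -natr1 [_ + 1]addrC addrK mul1r.
    by rewrite cmod_scale cmod_circ mulr1 gtr0_norm ?divr_gt0// ltr_pdivrMr// mulrC.
  have cH : continuous (H i.+1).
    move=> t; rewrite /H.
    apply: (@continuous_comp _ _ _ (fun t => l0 + (i.+1%:R * (B / n%:R)) *: circ t) g) (cg _).
    apply: cvgD; first exact: cvg_cst.
    exact: (@continuous_comp _ _ _ circ _ t (@circ_continuous t) (@scaler_continuous _ _ _ _)).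
  have c1 : continuous (fun t => (H i.+1 t).1).
    by move=> t; apply: continuous_comp; [exact: cH|exact: cvg_fst].
  have c2 : continuous (fun t => (H i.+1 t).2).
    by move=> t; apply: continuous_comp; [exact: cH|exact: cvg_snd].
  have cc : continuous (cos \o A).
    by move=> t; apply: continuous_comp; [exact: cA|exact: continuous_cos].
  have cs : continuous (sin \o A).
    by move=> t; apply: continuous_comp; [exact: cA|exact: continuous_sin].
  pose re t := cos (A t) * (H i.+1 t).1 + sin (A t) * (H i.+1 t).2.
  pose im t := cos (A t) * (H i.+1 t).2 - sin (A t) * (H i.+1 t).1.
  have key t : 0 < re t /\ circ (A t + atan (im t / re t)) = H i.+1 t.
    exact: close_circ (g1 _) (step t).
  exists (fun t => A t + atan (im t / re t)); split.
  - move=> t; apply: cvgD; first exact: cA.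
    apply: (@continuous_comp _ _ _ (fun t => im t / re t) (@atan R) t); last first.
      exact: continuous_atan.
    apply: cvgM; first by apply: cvgB; apply: cvgM; [exact: cc|exact: c2|exact: cs|exact: c1].
    apply: cvgV; first by rewrite gt_eqF// (key t).1.
    by apply: cvgD; apply: cvgM; [exact: cc|exact: c1|exact: cs|exact: c2].
  - have H2 : H i.+1 (pi *+ 2) = H i.+1 0 by rewrite /H -[pi *+ 2]add0r circD2pi.
    by rewrite /re /im H2 -A2.
  - by move=> t; rewrite (key t).2.
have [A [cA A2 HA]] := lift n (leqnn n).
have {}HA t : circ t = circ (A t).
  by rewrite -HA /H mulrC divfK ?gt_eqF// gB.
(* [w] takes only multiples of 2 pi as values, yet grows by 2 pi over one period since [A] agrees at
   0 and 2 pi; at the intermediate value [w 0 + pi] the cosine would be -1. *)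
pose w t : R := t - A t.
have cw : continuous w by move=> t; apply: cvgB; [exact: cvg_id|exact: cA].
have cosw t : cos (w t) = 1.
  have [cE sE] := HA t; rewrite /w cosD cosN sinN -cE -sE mulrN opprK.
  by rewrite -!expr2 cos2Dsin2.
have pi0 := pi_gt0 R.
have w2 : w (pi *+ 2) = w 0 + pi *+ 2 by rewrite /w -A2; ring.
have ab : 0 <= (pi : R) *+ 2 by rewrite mulrn_wge0// ltW.
have mm : Num.min (w 0) (w (pi *+ 2)) <= w 0 + pi <= Num.max (w 0) (w (pi *+ 2)).
  rewrite w2 ge_min le_max; apply/andP; split; apply/orP; [left|right].
    by rewrite lerDl ltW.
  by rewrite lerD2l mulr2n lerDl ltW.
have [t _ wt] := IVT ab (continuous_subspaceT cw) mm.
have := cosw t; rewrite wt cosDpi cosw; lra.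
Qed.

Lemma distance_continuous l0 : continuous (fun x => cmod (toC (x - l0))).
Proof.
move=> x; apply/cvgrPdist_lt => e e0; apply/near_cmodP; exists e => // y yx.
apply: le_lt_trans yx; rewrite ler_norml.
have := cmod_tri (toC x) (toC y) (toC l0); have := cmod_tri (toC y) (toC x) (toC l0).
by rewrite (cmodC (toC x) (toC y)) -!toCB; lra.
Qed.

(** * Directions and arguments seen from a base point *)

Definition direction l0 x : R * R := (cmod (toC (x - l0)))^-1 *: (x - l0).

Lemma direction_norm l0 x : cmod (toC (x - l0)) != 0 ->
  (direction l0 x).1 ^+ 2 + (direction l0 x).2 ^+ 2 = 1.
Proof.
move=> n0; rewrite -cmod_sqr cmod_scale ger0_norm ?invr_ge0 ?cmod_ge0// mulVf//.
by rewrite expr1n.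
Qed.

Lemma direction_continuous l0 x : cmod (toC (x - l0)) != 0 ->
  {for x, continuous (direction l0)}.
Proof.
move=> n0; apply: cvgZ; first by apply: cvgV => //; exact: distance_continuous.
by apply: cvgB; [exact: cvg_id|exact: cvg_cst].
Qed.

Lemma directionZ l0 x : cmod (toC (x - l0)) != 0 ->
  x - l0 = cmod (toC (x - l0)) *: direction l0 x.
Proof. by move=> n0; rewrite /direction scalerA mulfV ?scale1r. Qed.

Lemma cmodB_neq0 l0 x : x <> l0 -> cmod (toC (x - l0)) != 0.
Proof.
move=> xl; rewrite cmod_eq0; apply/eqP => E; apply: xl.
by apply: (@subr0_eq _ x l0); apply: toC_inj; rewrite E.
Qed.

Definition is_arg l0 x t := x - l0 = cmod (toC (x - l0)) *: circ t.

Lemma is_arg_direction l0 x t : x <> l0 -> is_arg l0 x t <-> direction l0 x = circ t.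
Proof.
move=> /cmodB_neq0 n0; split=> [E|E]; last by rewrite /is_arg -E -directionZ.
by rewrite /direction [X in _ *: X]E scalerA mulVf ?scale1r.
Qed.

Lemma circ_gap s t : circ s = circ t -> s < t -> s + pi *+ 2 <= t.
Proof.
move=> [cE sE] st; rewrite leNgt; apply/negP => lt.
have pi0 := pi_gt0 R.
have c1 : cos (t - s) = 1.
  by rewrite cosD cosN sinN -cE -sE mulrN opprK -!expr2 cos2Dsin2.
have lt' : t - s < pi + pi by move: lt; rewrite mulr2n; lra.
have inj (y : R) : 0 <= y -> y <= pi -> cos y = 1 -> y = 0.
  move=> y0 y1 cy; apply: cos_inj; rewrite ?cos0// in_itv /= ?y0// lexx/=; lra.
have [tp|tp] := leP (t - s) pi.
  by have := inj _ _ tp c1; lra.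
have c2 : cos (pi + pi - (t - s)) = 1.
  have := cosD2pi (- (t - s)); rewrite cosN c1 mulr2n => <-.
  by congr cos; ring.
by have := inj _ _ _ c2; lra.
Qed.

(** The direction of [y], turned by [-t], tends to 1, so [t] plus the arctangent of its slope is an
    argument of [y] close to [t]. *)
Lemma is_arg_near l0 x t (e : R) : x <> l0 -> is_arg l0 x t -> 0 < e ->
  \forall y \near x, exists2 t', `|t' - t| < e & is_arg l0 y t'.
Proof.
move=> xl ax e0; have n0 := cmodB_neq0 xl.
have ux : direction l0 x = circ t by apply/is_arg_direction.
have cu : direction l0 @ x --> circ t by rewrite -ux; exact: direction_continuous.
have c1 : (direction l0 y).1 @[y --> x] --> cos t.
  exact: (cvg_comp _ _ cu (@cvg_fst _ _ (nbhs (cos t)) (nbhs (sin t)) _)).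
have c2 : (direction l0 y).2 @[y --> x] --> sin t.
  exact: (cvg_comp _ _ cu (@cvg_snd _ _ (nbhs (cos t)) (nbhs (sin t)) _)).
pose re y := cos t * (direction l0 y).1 + sin t * (direction l0 y).2.
pose im y := cos t * (direction l0 y).2 - sin t * (direction l0 y).1.
have cre : re y @[y --> x] --> (1 : R).
  rewrite -(cos2Dsin2 t) !expr2; apply: cvgD; apply: cvgM => //; exact: cvg_cst.
have cim : im y @[y --> x] --> (0 : R).
  rewrite -(subrr (cos t * sin t)) [X in _ - X]mulrC.
  by apply: cvgB; apply: cvgM => //; exact: cvg_cst.
have cat : atan (im y / re y) @[y --> x] --> (0 : R).
  rewrite -atan0 -[in atan 0](mul0r (1 : R)^-1).
  apply: (cvg_comp (fun y => im y / re y) (@atan R)); last exact: continuous_atan.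
  by apply: cvgM => //; apply: cvgV => //; exact: oner_neq0.
have near_u : \forall y \near x, cmod (toC (direction l0 y - circ t)) < 1.
  have /cu : \forall u \near circ t, cmod (toC (u - circ t)) < 1.
    by apply/near_cmodP; exists 1.
  by [].
have near_n : \forall y \near x, cmod (toC (y - l0)) != 0.
  have p0 : 0 < cmod (toC (x - l0)) by rewrite lt_neqAle eq_sym n0 cmod_ge0.
  have /cvgrPdist_lt /(_ _ p0) := @distance_continuous l0 x.
  apply: filterS => y; apply: contraTneq => ->.
  by rewrite subr0 ger0_norm ?ltxx// cmod_ge0.
have /cvgrPdist_lt /(_ _ e0) near_t := cat.
near=> y; have ny : cmod (toC (y - l0)) != 0 by near: y.
have uy : cmod (toC (direction l0 y - circ t)) < 1 by near: y.
have [_ tE] := close_circ (direction_norm ny) uy.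
exists (t + atan (im y / re y)).
  rewrite [t + _]addrC addrK -normrN -sub0r; near: y; exact: near_t.
by rewrite /is_arg tE -directionZ.
Unshelve. all: by end_near. Qed.

(** The hypotheses make [N] open with frontier in [G]. A Tietze extension of [Th] gives unit vectors
    on [N] that agree on [G] with the direction from [l0]; continuing them by this direction outside
    [N] would retract a large disc onto its circle. *)
Lemma no_logarithm (N G : set (R * R)) (Th : R * R -> R) (l0 : R * R) :
  compact G -> N l0 -> (forall x, N x -> ~ G x) ->
  (forall x, N x -> \forall y \near x, N y) ->
  (forall x, ~ N x -> ~ G x -> \forall y \near x, ~ N y) ->
  (exists B, forall x, N x -> cmod (toC (x - l0)) <= B) ->
  {within G, continuous Th} ->
  (forall c, G c -> is_arg l0 c (Th c)) -> False.
Proof.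
move=> cG Nl0 NG oN cN [B NB] cTh logG.
have [M M0 ThM] : exists2 M : R, 0 < M & forall c, G c -> `|Th c| <= M.
  have [M [_ MP]] := compact_bounded (continuous_compact cTh cG).
  exists (Num.max (M + 1) 1); first by rewrite lt_max ltr01 orbT.
  move=> c Gc; apply: (MP (Num.max (M + 1) 1)); last by exists c.
  by rewrite lt_max ltrDl ltr01.
have clG : closed G by apply: compact_closed => //; exact: norm_hausdorff.
have [T [ThT cT _]] := continuous_bounded_extension pseudometric_normal clG M0 cTh ThM.
pose n x : R := cmod (toC (x - l0)).
pose u x : R * R := direction l0 x.
pose g x := if pselect (N x) then circ (T x) else u x.
have nn x : ~ N x -> n x != 0 by move=> Nx; apply: cmodB_neq0 => E; rewrite E in Nx.
have nu x : n x != 0 -> (u x).1 ^+ 2 + (u x).2 ^+ 2 = 1 by exact: direction_norm.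
have cu x : n x != 0 -> {for x, continuous u} by exact: direction_continuous.
have cCT : continuous (circ \o T).
  by move=> x; apply: continuous_comp; [exact: cT|exact: circ_continuous].
have uG x : G x -> u x = circ (T x).
  move=> Gx; rewrite -ThT; last exact/mem_set.
  by apply/is_arg_direction; [move=> E; rewrite E in Gx; exact: NG Gx|exact: logG].
have cg : continuous g.
  move=> x; have [Nx|Nx] := pselect (N x).
    have E : {near x, circ \o T =1 g}.
      by apply: filterS (oN _ Nx) => y Ny; rewrite /g; case: pselect.
    have gx : g x = (circ \o T) x by rewrite /g; case: pselect.
    by rewrite /continuous_at gx; apply: cvg_trans (cCT x); exact: near_eq_cvg.
  have gx : g x = u x by rewrite /g; case: pselect.
  have [Gx|Gx] := pselect (G x); last first.
    have E : {near x, u =1 g}.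
      by apply: filterS (cN _ Nx Gx) => y Ny; rewrite /g; case: pselect.
    by rewrite /continuous_at gx; apply: cvg_trans (cu x (nn _ Nx)); exact: near_eq_cvg.
  rewrite /continuous_at; apply/cvgrPdist_lt => e e0.
  have /cvgrPdist_lt /(_ _ e0) h1 := cu x (nn _ Nx).
  have /cvgrPdist_lt /(_ _ e0) h2 := cCT x.
  near=> y.
  have a1 : `|u x - u y| < e by near: y.
  have a2 : `|circ (T x) - circ (T y)| < e by near: y.
  by rewrite gx /g; case: pselect => Ny //; rewrite uG.
have g1 x : (g x).1 ^+ 2 + (g x).2 ^+ 2 = 1.
  by rewrite /g; case: pselect => Nx; [exact: circ_norm|exact/nu/nn].
pose B' : R := Num.max (B + 1) 1.
have B0 : 0 < B' by rewrite lt_max ltr01 orbT.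
apply: (no_retraction B0 cg g1).
  by exists (T l0); rewrite /g; case: pselect.
move=> t; rewrite /g; have nB : n (l0 + B' *: circ t) = B'.
  by rewrite /n addrC addKr cmod_scale cmod_circ mulr1 gtr0_norm.
case: pselect => [Nt|?].
  have : n (l0 + B' *: circ t) <= B by exact: NB.
  have BB' : B < B' by rewrite /B' lt_max ltrDl ltr01.
  by rewrite nB leNgt BB'.
by rewrite /= /u /direction -/(n _) nB [_ + _ - _]addrC addKr scalerA mulVf ?scale1r// gt_eqF.
Unshelve. all: by end_near. Qed.

End NoLogarithm.

(** * The uniform algebra of a compact set and peak functions *)

Section UniformLimits.
Variable R : realType.
Local Notation C := R[i].
Local Notation T := ((R * R) * (R * R))%type.

Lemma peval2E (P : {poly {poly C}}) (k : T) : peval2 P k = P.[(toC k.2)%:P].[toC k.1].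
Proof. by []. Qed.

Lemma peval2D (P Q : {poly {poly C}}) (k : T) : peval2 (P + Q) k = peval2 P k + peval2 Q k.
Proof. by rewrite !peval2E !hornerD. Qed.

Lemma peval2M (P Q : {poly {poly C}}) (k : T) : peval2 (P * Q) k = peval2 P k * peval2 Q k.
Proof. by rewrite !peval2E !hornerM. Qed.

Lemma peval2_fst (a : {poly C}) (k : T) : peval2 a%:P k = a.[toC k.1].
Proof. by rewrite peval2E hornerC. Qed.

Lemma peval2_snd (a : {poly C}) (k : T) : peval2 (map_poly polyC a) k = a.[toC k.2].
Proof. by rewrite peval2E horner_map hornerC. Qed.

Lemma peval2_const (a : C) (k : T) : peval2 a%:P%:P k = a.
Proof. by rewrite peval2_fst hornerC. Qed.

Lemma near_fst (k : T) (P : R * R -> Prop) :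
  (\forall u \near k.1, P u) -> \forall x \near k, P x.1.
Proof. by move=> Pk; have := @cvg_fst _ _ (nbhs k.1) (nbhs k.2) _; apply. Qed.

Lemma near_snd (k : T) (P : R * R -> Prop) :
  (\forall u \near k.2, P u) -> \forall x \near k, P x.2.
Proof. by move=> Pk; have := @cvg_snd _ _ (nbhs k.1) (nbhs k.2) _; apply. Qed.

Lemma poly_bounded (a : {poly C}) (B : R) :
  exists2 M : R, 0 <= M & forall z, cmod z <= B -> cmod a.[z] <= M.
Proof.
elim/poly_ind: a => [|a c [M M0 aM]].
  by exists 0 => // z _; rewrite horner0 cmod0.
have [B0|B0] := leP 0 B; last first.
  by exists 0 => // z zB; have := cmod_ge0 z; lra.
exists (M * B + cmod c); first by rewrite addr_ge0 ?mulr_ge0 ?cmod_ge0.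
move=> z zB; rewrite !hornerE; apply: le_trans (cmodD _ _) _.
by rewrite lerD2r cmodM ler_pM ?cmod_ge0 ?aM.
Qed.

Lemma poly_cts (a : {poly C}) (x : R * R) (e : R) : 0 < e ->
  \forall y \near x, cmod (a.[toC y] - a.[toC x]) < e.
Proof.
move=> e0; have [q qE] : exists q, a - (a.[toC x])%:P = q * ('X - (toC x)%:P).
  by apply/factor_theorem; rewrite rootE !hornerE subrr.
have [M M0 qM] := poly_bounded q (cmod (toC x) + 1).
apply/near_cmodP; exists (Num.min 1 (e / (M + 1))).
  by rewrite lt_min ltr01 divr_gt0//; lra.
move=> y; rewrite lt_min => /andP[y1 ye].
have -> : a.[toC y] - a.[toC x] = q.[toC y] * toC (y - x).
  by have := congr1 (fun b : {poly C} => b.[toC y]) qE; rewrite hornerM !hornerE.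
rewrite cmodM; apply: (@le_lt_trans _ _ (M * cmod (toC (y - x)))).
  rewrite ler_wpM2r ?cmod_ge0// qM//.
  by have := cmod_lerB (toC y) (toC x); rewrite -toCB; lra.
apply: (@le_lt_trans _ _ (M * (e / (M + 1)))); first by rewrite ler_wpM2l// ltW.
have M1 : 0 < M + 1 by lra.
by rewrite mulrA ltr_pdivrMr// mulrC ltr_pM2l//; lra.
Qed.

Variable K : set T.
Hypothesis K_compact : compact K.

Lemma fst_snd_bounded : exists2 B : R, 0 <= B & forall k, K k ->
  cmod (toC k.1) <= B /\ cmod (toC k.2) <= B.
Proof.
have [M [_ MP]] := compact_bounded K_compact.
have m0 : 0 <= Num.max (M + 1) 1 by rewrite le_max ler01 orbT.
exists (2 * Num.max (M + 1) 1); first by rewrite mulr_ge0.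
move=> k Kk; have : `|k| <= Num.max (M + 1) 1.
  by apply: (MP (Num.max (M + 1) 1)) => //; rewrite lt_max ltrDl ltr01.
rewrite !prod_normE !ge_max => /andP[/andP[a b] /andP[a' b']].
by split; apply: le_trans (cmod_le_sum _) _; rewrite mulrDl mul1r lerD.
Qed.

Lemma peval2_bounded (P : {poly {poly C}}) :
  exists2 M : R, 0 <= M & forall k, K k -> cmod (peval2 P k) <= M.
Proof.
have [B B0 KB] := fst_snd_bounded.
elim/poly_ind: P => [|P a [M M0 PM]].
  by exists 0 => // k _; rewrite peval2E !horner0 cmod0.
have [N N0 aN] := poly_bounded a B.
exists (M * B + N); first by rewrite addr_ge0 ?mulr_ge0.
move=> k Kk; have [k1 k2] := KB _ Kk.
rewrite peval2D peval2M peval2_fst; apply: le_trans (cmodD _ _) _.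
by rewrite lerD ?aN// cmodM ler_pM ?cmod_ge0 ?PM// peval2E hornerX hornerC.
Qed.

Definition ulim (f : T -> C) := forall e : R, 0 < e ->
  exists P : {poly {poly C}}, forall k, K k -> cmod (f k - peval2 P k) <= e.

Lemma ulim_peval2 P : ulim (peval2 P).
Proof. by move=> e e0; exists P => k _; rewrite subrr cmod0 ltW. Qed.

Lemma ulim_eq f g : (forall k, K k -> f k = g k) -> ulim f -> ulim g.
Proof. by move=> fg uf e /uf[P PP]; exists P => k Kk; rewrite -fg// PP. Qed.

Lemma ulim_cst (a : C) : ulim (fun=> a).
Proof. by apply: ulim_eq (ulim_peval2 a%:P%:P) => k _; rewrite peval2_const. Qed.

Lemma ulim_fst (a : {poly C}) : ulim (fun k => a.[toC k.1]).
Proof. by apply: ulim_eq (ulim_peval2 a%:P) => k _; rewrite peval2_fst. Qed.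

Lemma ulim_snd (a : {poly C}) : ulim (fun k => a.[toC k.2]).
Proof. by apply: ulim_eq (ulim_peval2 (map_poly polyC a)) => k _; rewrite peval2_snd. Qed.

Lemma ulim_bounded f : ulim f -> exists2 M : R, 0 <= M & forall k, K k -> cmod (f k) <= M.
Proof.
move=> /(_ 1 ltr01)[P PP]; have [M M0 PM] := peval2_bounded P.
exists (M + 1) => [|k Kk]; first lra.
have := cmodD (f k - peval2 P k) (peval2 P k); rewrite subrK.
by have := PP _ Kk; have := PM _ Kk; lra.
Qed.

Lemma ulimD f g : ulim f -> ulim g -> ulim (fun k => f k + g k).
Proof.
move=> uf ug e e0; have e2 : 0 < e / 2 by lra.
have [P PP] := uf _ e2; have [Q QQ] := ug _ e2.
exists (P + Q) => k Kk; rewrite peval2D opprD addrACA.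
by have := cmodD (f k - peval2 P k) (g k - peval2 Q k); have := PP _ Kk; have := QQ _ Kk; lra.
Qed.

Lemma ulimM f g : ulim f -> ulim g -> ulim (fun k => f k * g k).
Proof.
move=> uf ug e e0; have [M M0 fM] := ulim_bounded uf.
have e1 : 0 < e / (2 * (M + 1)) by rewrite divr_gt0// mulr_gt0//; lra.
have [Q QQ] := ug _ e1; have [N N0 QN] := peval2_bounded Q.
have e2 : 0 < e / (2 * (N + 1)) by rewrite divr_gt0// mulr_gt0//; lra.
have [P PP] := uf _ e2.
exists (P * Q) => k Kk; rewrite peval2M.
have -> : f k * g k - peval2 P k * peval2 Q k =
  f k * (g k - peval2 Q k) + (f k - peval2 P k) * peval2 Q k by ring.
apply: le_trans (cmodD _ _) _; rewrite !cmodM.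
have h1 : cmod (f k) * cmod (g k - peval2 Q k) <= (M + 1) * (e / (2 * (M + 1))).
  by apply: ler_pM; rewrite ?cmod_ge0 ?QQ//; have := fM _ Kk; lra.
have h2 : cmod (f k - peval2 P k) * cmod (peval2 Q k) <= e / (2 * (N + 1)) * (N + 1).
  by apply: ler_pM; rewrite ?cmod_ge0 ?PP//; have := QN _ Kk; lra.
have k1 : (M + 1) * (e / (2 * (M + 1))) = e / 2 by field; rewrite gt_eqF//; lra.
have k2 : e / (2 * (N + 1)) * (N + 1) = e / 2 by field; rewrite gt_eqF//; lra.
by rewrite k1 in h1; rewrite k2 in h2; lra.
Qed.

Lemma ulimZ a f : ulim f -> ulim (fun k => a * f k).
Proof. exact: ulimM (ulim_cst a). Qed.

Lemma ulimN f : ulim f -> ulim (fun k => - f k).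
Proof. by move=> /(ulimZ (-1)); apply: ulim_eq => k _; rewrite mulN1r. Qed.

Lemma ulimB f g : ulim f -> ulim g -> ulim (fun k => f k - g k).
Proof. by move=> uf /ulimN; exact: ulimD. Qed.

Lemma ulim_closed f : (forall e : R, 0 < e -> exists2 g, ulim g &
  forall k, K k -> cmod (f k - g k) <= e) -> ulim f.
Proof.
move=> H e e0; have e2 : 0 < e / 2 by lra.
have [g ug fg] := H _ e2; have [P PP] := ug _ e2; exists P => k Kk.
by have := cmod_tri (g k) (f k) (peval2 P k); have := fg _ Kk; have := PP _ Kk; lra.
Qed.

Lemma ulim_fstB (l : C) : ulim (fun k => toC k.1 - l).
Proof. by apply: ulim_eq (ulim_fst ('X - l%:P)) => k _; rewrite !hornerE. Qed.

(* [qnorm l g M]: modulo the ideal of the uniform algebra generated by [c - l],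
   the function [g] has norm at most [M]. *)
Definition qnorm (l : C) (g : T -> C) (M : R) := exists2 b, ulim b &
  forall k, K k -> cmod (g k - (toC k.1 - l) * b k) <= M.

Definition free (l : C) := ulim (fun k => (toC k.1 - l)^-1).

Definition off (l : C) (d : R) := forall k, K k -> d <= cmod (toC k.1 - l).

Lemma off_neq0 l d k : 0 < d -> off l d -> K k -> toC k.1 - l != 0.
Proof. by move=> d0 o Kk; rewrite -cmod_gt0 (lt_le_trans d0)// o. Qed.

Lemma qnorm_le l g M M' : M <= M' -> qnorm l g M -> qnorm l g M'.
Proof. by move=> le [b ub bM]; exists b => // k /bM /le_trans; apply. Qed.

Lemma qnorm_eq l f g M : (forall k, K k -> f k = g k) -> qnorm l f M -> qnorm l g M.
Proof. by move=> fg [b ub bM]; exists b => // k Kk; rewrite -fg// bM. Qed.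

Lemma qnorm_bound l g M : (forall k, K k -> cmod (g k) <= M) -> qnorm l g M.
Proof.
by move=> gM; exists (fun=> 0); [exact: ulim_cst|move=> k Kk; rewrite mulr0 subr0 gM].
Qed.

Lemma qnormD l f g M N : qnorm l f M -> qnorm l g N -> qnorm l (fun k => f k + g k) (M + N).
Proof.
move=> [b ub bM] [c uc cN]; exists (fun k => b k + c k); first exact: ulimD.
move=> k Kk; rewrite mulrDr opprD addrACA; apply: le_trans (cmodD _ _) _.
by rewrite lerD ?bM ?cN.
Qed.

Lemma qnormN l g M : qnorm l g M -> qnorm l (fun k => - g k) M.
Proof.
move=> [b ub bM]; exists (fun k => - b k); first exact: ulimN.
by move=> k Kk; rewrite mulrN -opprD cmodN bM.
Qed.

Lemma qnormM l f g M N : ulim f -> ulim g -> qnorm l f M -> qnorm l g N ->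
  qnorm l (fun k => f k * g k) (M * N).
Proof.
move=> uf ug [b ub bM] [c uc cN].
exists (fun k => b k * g k + (f k - (toC k.1 - l) * b k) * c k).
  apply: ulimD; first exact: ulimM.
  by apply: ulimM => //; apply: ulimB => //; apply: ulimM => //; exact: ulim_fstB.
move=> k Kk; set z := toC k.1 - l.
have -> : f k * g k - z * (b k * g k + (f k - z * b k) * c k) =
  (f k - z * b k) * (g k - z * c k) by ring.
by rewrite cmodM ler_pM ?cmod_ge0 ?bM ?cN.
Qed.

Lemma free_qnorm l g d : 0 < d -> off l d -> free l -> ulim g -> qnorm l g 0.
Proof.
move=> d0 o fl ug; exists (fun k => (toC k.1 - l)^-1 * g k); first exact: ulimM.
by move=> k Kk; rewrite mulrA mulfV ?mul1r ?subrr ?cmod0// (off_neq0 d0 o Kk).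
Qed.

(** Neumann series: with [y = 1 - (c - l) b] of modulus at most [M < 1], [1 - y^n] is [c - l] times
    an element of the algebra, which differs from [1 / (c - l)] by [y^n / (c - l)]. *)
Lemma qnorm1_free l d M : 0 < d -> off l d -> 0 <= M < 1 -> qnorm l (fun=> 1) M -> free l.
Proof.
move=> d0 o /andP[M0 M1] [b ub bM].
pose y k := 1 - (toC k.1 - l) * b k.
have uy : ulim y.
  by apply: ulimB; [exact: ulim_cst|apply: ulimM => //; exact: ulim_fstB].
have geo n : exists2 g, ulim g & forall k, 1 - y k ^+ n = (toC k.1 - l) * g k.
  elim: n => [|n [g ug gE]].
    by exists (fun=> 0); [exact: ulim_cst|move=> k; rewrite expr0 subrr mulr0].
  exists (fun k => b k + y k * g k); first by apply: ulimD => //; exact: ulimM.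
  move=> k; rewrite mulrDr mulrCA -gE exprS.
  have -> : (toC k.1 - l) * b k = 1 - y k by rewrite /y; ring.
  by ring.
apply: ulim_closed => e e0.
have [n nP] : exists n, M ^+ n < e * d.
  have : (GRing.exp M) @ \oo --> (0 : R) by apply: cvg_expr; rewrite ger0_norm.
  move=> /cvgr0Pnorm_lt /(_ _ (mulr_gt0 e0 d0)) [n _ /(_ n (leqnn n))].
  by rewrite ger0_norm ?exprn_ge0//; exists n.
have [g ug gE] := geo n; exists g => // k Kk.
have z0 := off_neq0 d0 o Kk.
have -> : (toC k.1 - l)^-1 - g k = y k ^+ n / (toC k.1 - l).
  apply: (mulIf z0); rewrite divfK// mulrBl mulVf// [g k * _]mulrC -gE; ring.
rewrite cmodM cmodV cmodX ler_pdivrMr ?(lt_le_trans d0) ?o//.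
apply: (@le_trans _ _ (M ^+ n)).
  by apply: lerXn2r; rewrite ?nnegrE ?cmod_ge0 ?bM.
by rewrite (le_trans (ltW nP))// ler_wpM2l ?o// ltW.
Qed.

Lemma free_near l0 l1 d d0 : 0 < d -> 0 < d0 -> off l1 d -> off l0 d0 ->
  cmod (l0 - l1) <= d / 2 -> free l1 -> free l0.
Proof.
move=> dp d0p o1 o0 ll f1; apply: (@qnorm1_free _ d0 (1/2)) => //; first by lra.
exists (fun k => (toC k.1 - l1)^-1) => // k Kk.
have z0 := off_neq0 dp o1 Kk.
have -> : 1 - (toC k.1 - l0) * (toC k.1 - l1)^-1 = (l0 - l1) / (toC k.1 - l1).
  by apply: (mulIf z0); rewrite divfK// mulrBl -mulrA mulVf// mul1r mulr1; ring.
rewrite cmodM cmodV ler_pdivrMr ?(lt_le_trans dp) ?o1//.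
have := o1 _ Kk; lra.
Qed.

Lemma free_far B l : (forall k, K k -> cmod (toC k.1) <= B) -> 0 < cmod l ->
  2 * B <= cmod l -> free l.
Proof.
move=> KB l0 lB; have l00 : l != 0 by rewrite -cmod_gt0.
apply: (@qnorm1_free _ (cmod l / 2) (1/2)).
- by rewrite divr_gt0.
- by move=> k Kk; rewrite cmodC; have := cmod_lerB l (toC k.1); have := KB _ Kk; lra.
- by lra.
exists (fun=> - l^-1); first exact: ulim_cst.
move=> k Kk; have -> : 1 - (toC k.1 - l) * - l^-1 = toC k.1 / l.
  by apply: (mulIf l00); rewrite mulrBl mulrN mulNr opprK mul1r !mulfVK//; ring.
by rewrite cmodM cmodV ler_pdivrMr//; have := KB _ Kk; lra.
Qed.

(** * Peaking over one fibre *)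

Lemma bernoulli_le (x : R) n : 0 <= x <= 1 -> 1 - n%:R * x <= (1 - x) ^+ n.
Proof.
move=> /andP[x0 x1]; elim: n => [|n IH]; first by rewrite mul0r subr0 expr0.
rewrite exprS; apply: (@le_trans _ _ ((1 - x) * (1 - n%:R * x))).
  rewrite -natr1; have : 0 <= n%:R * x * x by rewrite !mulr_ge0.
  by rewrite [(_ + 1) * x]mulrDl mul1r mulrBl mul1r mulrBr mulr1 mulrCA; lra.
by rewrite ler_wpM2l//; lra.
Qed.

(** Near the fibre over [p], where [g] is below [M'], every exponent works because the peaking
    factor is at most 1; near any other point of [K] large powers beat the local bound of [g].
    Compactness yields a common exponent. *)
Lemma peak_power (D : R) (l : C) (p : R * R) (g : T -> C) (M M' : R) :
  0 < D -> 0 <= M -> M < M' ->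
  (forall k, K k -> D <= cmod (toC k.1 - l)) ->
  (forall k, K k -> k.1 != p -> D < cmod (toC k.1 - l)) ->
  (forall k (e : R), 0 < e -> \forall x \near k, cmod (g x - g k) < e) ->
  (forall k, K k -> k.1 = p -> cmod (g k) <= M) ->
  exists n, forall k, K k -> (D / cmod (toC k.1 - l)) ^+ n * cmod (g k) <= M'.
Proof.
move=> D0 M0 MM' off_l strict cg gM.
have /compact_near_coveringP/near_covering_withinP cov := K_compact.
have q1 k : K k -> 0 <= D / cmod (toC k.1 - l) <= 1.
  move=> Kk; have := off_l _ Kk => Dk.
  rewrite divr_ge0 ?cmod_ge0 ?(ltW D0)//= ler_pdivrMr ?mul1r//; lra.
have : \forall n \near \oo, K `<=` fun k => (D / cmod (toC k.1 - l)) ^+ n * cmod (g k) <= M'.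
  apply: cov => x Kx; have [xp|xp] := eqVneq x.1 p.
    have e0 : 0 < M' - M by lra.
    exists ([set y | cmod (g y - g x) < M' - M], setT) => /=.
      by split; [exact: cg|exact: filterT].
    move=> [y n] /= [gy _] Ky; have /andP[qa qb] := q1 _ Ky.
    have : cmod (g y) <= M'.
      by have := cmodD (g y - g x) (g x); rewrite subrK; have := gM _ Kx xp; lra.
    apply: le_trans; rewrite ler_piMl ?cmod_ge0// exprn_ile1//.
  pose d := cmod (toC x.1 - l); have Dd : D < d := strict _ Kx xp.
  pose D2 := (D + d) / 2; pose q := D / D2.
  have D20 : 0 < D2 by rewrite /D2; lra.
  have q0 : 0 <= q by rewrite divr_ge0 ?ltW.
  have q1' : q < 1 by rewrite ltr_pdivrMr// mul1r /D2; lra.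
  have e0 : 0 < M' / (cmod (g x) + 1).
    by rewrite divr_gt0//; [lra|have := cmod_ge0 (g x); lra].
  have qn : \forall n \near \oo, q ^+ n < M' / (cmod (g x) + 1).
    have : (GRing.exp q) @ \oo --> (0 : R) by apply: cvg_expr; rewrite ger0_norm.
    move=> /cvgr0Pnorm_lt /(_ _ e0); apply: filterS => n.
    by rewrite ger0_norm ?exprn_ge0.
  have nx : \forall y \near x, cmod (toC (y.1 - x.1)) < (d - D) / 2.
    apply: (near_fst (k := x) (P := fun u => cmod (toC (u - x.1)) < (d - D) / 2)).
    by apply/near_cmodP; exists ((d - D) / 2) => //; lra.
  exists ([set y | cmod (g y - g x) < 1 /\ cmod (toC (y.1 - x.1)) < (d - D) / 2],
     [set n | q ^+ n < M' / (cmod (g x) + 1)]) => /=.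
    by split => //; apply: filterI => //; exact: cg.
  move=> [y n] /= [[gy yx] qy] Ky.
  have qa : D / cmod (toC y.1 - l) <= q.
    have D2y : D2 <= cmod (toC y.1 - l).
      have := cmod_tri (toC y.1) (toC x.1) l.
      by rewrite (cmodC (toC x.1) (toC y.1)) -toCB -/d /D2; lra.
    by rewrite /q ler_pM2l// lef_pV2 ?posrE// (lt_le_trans D20).
  have gb : cmod (g y) <= cmod (g x) + 1.
    by have := cmodD (g y - g x) (g x); rewrite subrK; lra.
  have g10 : 0 < cmod (g x) + 1 by have := cmod_ge0 (g x); lra.
  apply: (@le_trans _ _ (M' / (cmod (g x) + 1) * (cmod (g x) + 1))); last by rewrite divfK ?gt_eqF.
  apply: ler_pM; rewrite ?exprn_ge0 ?cmod_ge0//; first by have /andP[] := q1 _ Ky.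
  apply: le_trans (ltW qy); apply: lerXn2r; rewrite ?nnegrE//.
  by have /andP[] := q1 _ Ky.
by move=> /filter_ex[n nP]; exists n => k Kk; exact: nP.
Qed.

(* Multiplying [g] by high powers of the peaking function [(p - l) / (c - l)],
   which is a scalar modulo [c - m]. *)
Lemma peak_qnorm (l p : R * R) (g : T -> C) (M M' : R) :
  l != p -> free (toC l) ->
  (forall k, K k -> k.1 != p -> cmod (toC (p - l)) < cmod (toC (k.1 - l))) ->
  ulim g -> (forall k (e : R), 0 < e -> \forall x \near k, cmod (g x - g k) < e) ->
  0 <= M -> M < M' -> (forall k, K k -> k.1 = p -> cmod (g k) <= M) ->
  exists2 r : R, 0 < r & forall m, cmod (m - toC p) < r -> qnorm m g M'.
Proof.
move=> lp fl strict ug cg M0 MM' gM.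
set D := cmod (toC (p - l)) in strict *.
have D0 : 0 < D.
  rewrite /D cmod_gt0; apply: contra_neq lp => E.
  by apply/esym/(@subr0_eq _ p l); apply: toC_inj; rewrite E.
have offl : off (toC l) D.
  by move=> k Kk; have [->|/(strict _ Kk)/ltW] := eqVneq k.1 p.
(* Half of the margin goes to the peak power, the other half to [a^n], the scalar that represents
   [f^n] modulo [c - m]. *)
have M1M' : (M + M') / 2 < M' by lra.
have MM1 : M < (M + M') / 2 by lra.
have [n nP] := peak_power D0 M0 MM1 offl strict cg gM.
pose f (k : T) := toC (p - l) / (toC k.1 - toC l) : C.
have uf : ulim f by apply: ulimM => //; exact: ulim_cst.
have cf k : cmod (f k) = D / cmod (toC k.1 - toC l) by rewrite /f cmodM cmodV.
(* For [|m - p| < r], Bernoulli's inequality keeps [|a|^n] at least [(M + M') / (2 M')]. *)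
pose r := Num.min (D / 2) (D * (1 - (M + M') / 2 / M') / (n%:R + 1)).
have M'0 : 0 < M' by lra.
have c0 : 0 < 1 - (M + M') / 2 / M' by rewrite subr_gt0 ltr_pdivrMr// mul1r.
have n10 : (0 : R) < n%:R + 1 by rewrite ltr_wpDl// ler0n.
have r0 : 0 < r by rewrite lt_min !divr_gt0// mulr_gt0.
exists r => // m mp; move: (mp); rewrite lt_min => /andP[mD mr].
have ml : D - cmod (m - toC p) <= cmod (m - toC l) <= D + cmod (m - toC p).
  have := cmod_tri m (toC p) (toC l); have := cmod_tri (toC p) m (toC l).
  by rewrite (cmodC _ m) -[toC p - toC l]toCB -/D; lra.
have ml0 : m - toC l != 0 by rewrite -cmod_gt0; case/andP: ml; lra.
pose a := toC (p - l) / (m - toC l) : C.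
have an : (M + M') / 2 / M' <= cmod (a ^+ n).
  rewrite cmodX cmodM cmodV -/D.
  set t := cmod (m - toC p) in mp mD mr ml *.
  have t0 : 0 <= t by exact: cmod_ge0.
  have x01 : 0 <= t / D <= 1 by rewrite divr_ge0 ?(ltW D0)//= ler_pdivrMr// mul1r; lra.
  apply: (@le_trans _ _ ((1 - t / D) ^+ n)).
    apply: le_trans (bernoulli_le n x01).
    suff : n%:R * (t / D) <= 1 - (M + M') / 2 / M' by lra.
    rewrite mulrA ler_pdivrMr// [leRHS]mulrC.
    move: mr; rewrite ltr_pdivlMr// => mr.
    have : n%:R * t <= t * (n%:R + 1) by rewrite mulrDr mulr1 mulrC; lra.
    lra.
  apply: lerXn2r; rewrite ?nnegrE ?divr_ge0 ?cmod_ge0//; first by case/andP: x01; lra.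
  rewrite ler_pdivlMr ?cmod_gt0//; apply: (@le_trans _ _ ((1 - t / D) * (D + t))).
    by rewrite ler_wpM2l//; case/andP: ml x01 => _ ? /andP[_]; lra.
  have -> : (1 - t / D) * (D + t) = D - t ^+ 2 / D by field; rewrite gt_eqF.
  by rewrite gerBl divr_ge0 ?sqr_ge0// ltW.
have a0 : a ^+ n != 0.
  by rewrite -cmod_gt0; apply: lt_le_trans an; rewrite divr_gt0//; lra.
(* [f - a] is [c - m] times [- f / (m - l)], so all differences of powers lie in the ideal. *)
have [b ub bE] : exists2 b, ulim b & forall k, K k -> f k ^+ n - a ^+ n = (toC k.1 - m) * b k.
  elim: (n) => [|i [b ub bE]].
    by exists (fun=> 0); [exact: ulim_cst|move=> k _; rewrite !expr0 subrr mulr0].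
  exists (fun k => f k * b k + a ^+ i * (- (m - toC l)^-1 * f k)).
    by apply: ulimD; [exact: ulimM|apply: ulimZ; exact: ulimZ].
  move=> k Kk; have z0 := off_neq0 D0 offl Kk.
  have -> : f k ^+ i.+1 - a ^+ i.+1 = f k * (f k ^+ i - a ^+ i) + a ^+ i * (f k - a).
    by rewrite !exprS; ring.
  rewrite bE// (_ : f k - a = (toC k.1 - m) * (- (m - toC l)^-1 * f k)); first by ring.
  by rewrite /f /a; field; rewrite ml0 z0.
exists (fun k => - (a ^+ n)^-1 * (b k * g k)); first by apply: ulimZ; exact: ulimM.
move=> k Kk.
have -> : g k - (toC k.1 - m) * (- (a ^+ n)^-1 * (b k * g k)) = (a ^+ n)^-1 * (f k ^+ n * g k).
  have -> : f k ^+ n = a ^+ n + (toC k.1 - m) * b k by rewrite -bE//; ring.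
  by field; exact: a0.
rewrite cmodM cmodV cmodM [cmod (f k ^+ n)]cmodX cf mulrC ler_pdivrMr ?cmod_gt0//.
apply: le_trans (nP _ Kk) _.
by rewrite [leRHS]mulrC -ler_pdivrMr.
Qed.

End UniformLimits.

(** * Free sides *)

Section Sides.
Variable R : realType.
Local Notation T := ((R * R) * (R * R))%type.
Variable K : set T.
Hypothesis K_compact : compact K.

Definition shadow : set (R * R) := [set x | exists w, K (x, w)].

Lemma shadow_fst k : K k -> shadow k.1.
Proof. by case: k => x w Kk; exists w. Qed.

Lemma shadow_image : shadow = fst @` K.
Proof.
apply/seteqP; split=> [x [w Kw]|x [k Kk <-]]; [by exists (x, w)|exact: shadow_fst].
Qed.

Lemma shadow_compact : compact shadow.
Proof.
rewrite shadow_image; apply: continuous_compact => //.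
by apply: continuous_subspaceT => k; exact: cvg_fst.
Qed.

Lemma near_not_shadow x : ~ shadow x -> \forall y \near x, ~ shadow y.
Proof.
move=> nx; have cl : closed shadow.
  by apply: compact_closed shadow_compact; exact: norm_hausdorff.
by have := closed_openC cl; rewrite openE => /(_ x nx).
Qed.

Lemma not_shadow_off x : ~ shadow x -> exists2 d : R, 0 < d & off K (toC x) d.
Proof.
move=> /near_not_shadow /near_cmodP[d d0 dP]; exists d => // k Kk.
by rewrite leNgt; apply/negP => /(dP k.1); apply; exact: shadow_fst.
Qed.

Lemma free_locally x : ~ shadow x ->
  \forall y \near x, free K (toC y) <-> free K (toC x).
Proof.
move=> /not_shadow_off[d d0 o]; apply/near_cmodP; exists (d / 4); first by lra.
move=> y yx; have oy : off K (toC y) (3 * d / 4).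
  move=> k Kk; have := o _ Kk; have := cmod_tri (toC y) (toC k.1) (toC x).
  by rewrite -[toC y - toC x]toCB; lra.
have d3 : 0 < 3 * d / 4 by lra.
split.
  apply: (free_near K_compact d3 d0 oy o).
  by rewrite -cmodN opprB -toCB; lra.
by apply: (free_near K_compact d0 d3 o oy); rewrite -toCB; lra.
Qed.

Definition side_free (h : R * R -> R) (p : R * R) :=
  exists2 r : R, 0 < r & forall x, cmod (toC (x - p)) < r -> 0 < h x -> free K (toC x).

(** * Freeness along the positive side *)

Section OneSide.
Variable h : R * R -> R.
Hypothesis h_regular : forall p, h p = 0 -> regular_zero h p.
Hypothesis K_zero : forall k, K k -> h k.1 = 0.

Lemma positive_not_shadow x : 0 < h x -> ~ shadow x.
Proof. by move=> hx [w /K_zero /= h0]; rewrite h0 ltxx in hx. Qed.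

Lemma side_radius p (e : R) : shadow p -> 0 < e -> exists r : R, [/\ 0 < r, r <= e &
  forall x y, cmod (toC (x - p)) < r -> cmod (toC (y - p)) < r ->
  0 < h x -> 0 < h y -> (free K (toC x) <-> free K (toC y))].
Proof.
move=> [w /K_zero /= hp] e0.
have [r [r0 re rP]] := regular_zero_side_connected (h_regular hp) e0.
exists r; split => // x y xr yr hx hy; apply: (rP (fun x => free K (toC x))) => // z _ hz.
exact/free_locally/positive_not_shadow.
Qed.

Lemma free_side_free p (r : R) x : shadow p -> 0 < r ->
  (forall x y, cmod (toC (x - p)) < r -> cmod (toC (y - p)) < r ->
    0 < h x -> 0 < h y -> (free K (toC x) <-> free K (toC y))) ->
  cmod (toC (x - p)) < r -> 0 < h x -> free K (toC x) -> side_free h p.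
Proof. by move=> sp r0 rP xr hx fx; exists r => // y yr hy; apply/(rP y x). Qed.

(** The predicate is pulled back to [K], where connectedness is assumed. One ball from [side_radius]
    contains smaller balls about all nearby shadow points, and each of these has points with
    [h > 0], so a single such point decides for all. *)
Lemma side_free_all p q : connected K -> shadow p -> shadow q ->
  side_free h p -> side_free h q.
Proof.
move=> cK [w Kp] [w' Kq].
apply: (@connected_locally_constant _ K (fun k => side_free h k.1) cK _ (p, w) (q, w')) => //.
move=> k Kk; have sk := shadow_fst Kk.
have [r [r0 _ rP]] := side_radius sk (@ltr01 R).
have hk : forall k, K k -> regular_zero h k.1 by move=> k' /K_zero; exact: h_regular.
have : \forall u \near k.1, cmod (toC (u - k.1)) < r / 2.
  by apply/near_cmodP; exists (r / 2) => //; lra.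
move=> /near_fst; apply: filterS => k' /= k'r Kk'.
have r2 : 0 < r / 2 by lra.
have incl x : cmod (toC (x - k'.1)) < r / 2 -> cmod (toC (x - k.1)) < r.
  by have := cmod_tri (toC k'.1) (toC x) (toC k.1); rewrite -!toCB; lra.
split=> -[s s0 sP].
  have ms : 0 < Num.min s (r / 2) by rewrite lt_min s0.
  have [x xs hx] := regular_zero_side (hk _ Kk') ms.
  move: xs; rewrite lt_min => /andP[xs xr].
  exact: (free_side_free sk r0 rP (incl _ xr) hx (sP _ xs hx)).
have ms : 0 < Num.min s r by rewrite lt_min s0.
have [x xs hx] := regular_zero_side (hk _ Kk) ms.
move: xs; rewrite lt_min => /andP[xs xr].
exists (r / 2) => // y yr hy; exact/(rP y x (incl _ yr) xr hy hx)/(sP _ xs hx).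
Qed.

Lemma not_side_free p (r : R) : shadow p -> ~ side_free h p -> 0 < r ->
  exists x, [/\ cmod (toC (x - p)) < r, 0 < h x & ~ free K (toC x)].
Proof.
move=> sp ns r0; apply: contrapT => H; apply: ns; exists r => // x xr hx.
by apply: contrapT => nf; apply: H; exists x.
Qed.

End OneSide.

Lemma regular_zeroN_all (h : R * R -> R) : (forall p, h p = 0 -> regular_zero h p) ->
  forall p, - h p = 0 -> regular_zero (fun x => - h x) p.
Proof. by move=> hr p /eqP; rewrite oppr_eq0 => /eqP /hr; exact: regular_zeroN. Qed.

(* The points to the right of a rightmost point of the shadow can be pushed to
   infinity along a ray that avoids the shadow. *)
Lemma exists_free_side (h : R * R -> R) : (forall p, h p = 0 -> regular_zero h p) ->
  (forall k, K k -> h k.1 = 0) -> K !=set0 ->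
  exists2 p, shadow p & side_free h p \/ side_free (fun x => - h x) p.
Proof.
move=> hr K0 Kn0.
have KN0 k : K k -> - h k.1 = 0 by move=> /K0 ->; rewrite oppr0.
have [k Kk kmax] : exists2 k, K k & forall k', K k' -> k'.1.1 <= k.1.1.
  have c11 : {within K, continuous (fun k : T => k.1.1)}.
    apply: continuous_subspaceT => k.
    exact: (@continuous_comp _ _ _ fst fst k cvg_fst cvg_fst).
  have [k kK kmax] := compact_EVT_max Kn0 K_compact c11.
  by exists k => [|k' Kk']; [exact/set_mem|apply: kmax; exact/mem_set].
have sk := shadow_fst Kk; exists k.1 => //; set p := k.1 in sk kmax *.
have [B B0 KB] := fst_snd_bounded K_compact.
have right_free x : p.1 < x.1 -> free K (toC x).
  move=> px; pose y : R * R := (x.1 + (`|x.1| + (2 * B + 1)), x.2).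
  have nx : 0 <= `|x.1| by exact: normr_ge0.
  have x_ge : - x.1 <= `|x.1| by rewrite -normrN; exact: ler_norm.
  have fy : free K (toC y).
    have yn : 2 * B + 1 <= cmod (toC y).
      by apply: le_trans (cmod_fst y); apply: le_trans (ler_norm _); rewrite /=; lra.
    by apply: (free_far K_compact (B := B)) => [k' /KB[]||] //; lra.
  apply/(@segment_locally_constant _ (fun x => free K (toC x)) x y) => // t /andP[t0 t1].
  apply: free_locally => -[w /kmax]; rewrite /= leNgt => /negP; apply.
  rewrite /GRing.scale /= addrC [x.1 + _]addrC addrK; apply: lt_le_trans px _.
  by rewrite lerDr mulr_ge0//; lra.
have [r1 [r10 _ rP1]] := side_radius hr K0 sk (@ltr01 R).
have [r2 [r20 _ rP2]] := side_radius (regular_zeroN_all hr) KN0 sk (@ltr01 R).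
have [r3 r30 rP3] := regular_zero_dense_side (hr _ (K0 _ Kk)).
pose s := Num.min r1 (Num.min r2 r3) / 2.
have m0 : 0 < Num.min r1 (Num.min r2 r3) by rewrite !lt_min r10 r20.
have s0 : 0 < s by rewrite /s; lra.
have [sr1 sr2 sr3] : [/\ 2 * s <= r1, 2 * s <= r2 & 2 * s <= r3].
  by rewrite /s mulrC divfK//; split; rewrite !ge_min lexx ?orbT.
pose y : R * R := (p.1 + s, p.2).
have yp : cmod (toC (y - p)) <= s.
  apply: le_trans (cmod_le_sum _) _.
  by rewrite /= [p.1 + _]addrC addrK subrr normr0 addr0 gtr0_norm.
have fy : free K (toC y) by apply: right_free; rewrite /= ltrDl.
have [hy|hy|hy] := ltrgtP (h y) 0.
- right; have hy' : 0 < - h y by lra.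
  by apply: (free_side_free sk r20 rP2 _ hy' fy); lra.
- by left; apply: (free_side_free sk r10 rP1 _ hy fy); lra.
(* [h] may vanish at [y], which is off the shadow; a point with [h > 0] within [s] of [y] is still
   to the right of [p]. *)
have y3 : cmod (toC (y - p)) < r3 by lra.
have [x xy hx] := rP3 y s y3 hy s0.
left; apply: (free_side_free sk r10 rP1 _ hx).
  by have := cmod_tri (toC y) (toC x) (toC p); rewrite -!toCB; lra.
apply: right_free; have := le_lt_trans (cmod_fst _) xy; rewrite ltr_norml /=; lra.
Qed.

End Sides.

(** * Sheets of the fibres *)

Section Sheets.
Variable R : realType.
Local Notation C := R[i].
Local Notation T := ((R * R) * (R * R))%type.
Variables (K : set T) (h : R * R -> R).
Hypothesis K_compact : compact K.
Hypothesis h_regular : forall p, h p = 0 -> regular_zero h p.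
Hypothesis K_zero : forall k, K k -> h k.1 = 0.
Hypothesis neg_free : forall p, shadow K p -> side_free K (fun x => - h x) p.

Definition fqnorm (m : R * R) (Q : {poly C}) (M : R) :=
  qnorm K (toC m) (fun k : T => Q.[toC k.2]) M.

Lemma shadow_regular p : shadow K p -> regular_zero h p.
Proof. by move=> [w /K_zero]; exact: h_regular. Qed.

(** The centre [l] of the exterior disc has [h l < 0], so it is free: [(p - l) / (c - l)] is in the
    algebra and peaks exactly over [p]. The resulting bound holds for [m] on both sides of the
    shadow. *)
Lemma fiber_fqnorm p (Q : {poly C}) (M M' : R) : shadow K p -> 0 <= M -> M < M' ->
  (forall w, K (p, w) -> cmod Q.[toC w] <= M) ->
  exists2 r : R, 0 < r & forall m, cmod (toC (m - p)) < r -> fqnorm m Q M'.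
Proof.
move=> sp M0 MM' QM; have [s s0 sP] := neg_free sp.
have [l [ls hl strict]] := regular_zero_exterior_disc (shadow_regular sp) s0.
have fl : free K (toC l) by apply: sP => //; rewrite oppr_gt0.
have lp : l != p.
  by apply/eqP => E; move: hl; rewrite E; case: sp => w /K_zero /= ->; rewrite ltxx.
have [|||r r0 rP] := @peak_qnorm _ K K_compact l p (fun k : T => Q.[toC k.2]) M M' lp fl _
    (ulim_snd _ Q) _ M0 MM'.
- by move=> k Kk; apply: strict; exact: K_zero.
- move=> k e e0; apply: (near_snd (P := fun u => cmod (Q.[toC u] - Q.[toC k.2]) < e)).
  exact: poly_cts.
- by move=> [p' w] Kk /= E; apply: QM; rewrite -E.
by exists r => // m mr; apply: rP; rewrite -toCB.
Qed.

Lemma fqnorm_le m Q (M M' : R) : M <= M' -> fqnorm m Q M -> fqnorm m Q M'.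
Proof. exact: qnorm_le. Qed.

Lemma fqnormD m P Q (M N : R) : fqnorm m P M -> fqnorm m Q N -> fqnorm m (P + Q) (M + N).
Proof. by move=> a b; apply: qnorm_eq (qnormD a b) => k _; rewrite hornerD. Qed.

Lemma fqnormN m P (M : R) : fqnorm m P M -> fqnorm m (- P) M.
Proof. by move=> a; apply: qnorm_eq (qnormN K_compact a) => k _; rewrite hornerN. Qed.

Lemma fqnormM m P Q (M N : R) : fqnorm m P M -> fqnorm m Q N -> fqnorm m (P * Q) (M * N).
Proof.
move=> a b; apply: qnorm_eq (qnormM K_compact _ _ a b) => [k _||];
  [by rewrite hornerM|exact: ulim_snd|exact: ulim_snd].
Qed.

Variable th : T -> R.
Hypothesis th_cts : forall k (e : R), K k -> 0 < e ->
  \forall x \near k, K x -> `|th x - th k| < e.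

(* [Q] approximates on the fibre over [c] the indicator function of [t < th]. *)
Definition cut (e : R) (c : R * R) (t : R) (Q : {poly C}) := forall w, K (c, w) ->
  (t < th (c, w) -> cmod (Q.[toC w] - 1) <= e) /\ (th (c, w) < t -> cmod Q.[toC w] <= e).

Definition admissible (c : R * R) (t : R) := forall w, K (c, w) -> th (c, w) != t.

(** The threshold lies inside the gap between 0 and 1 that norms of idempotents avoid. *)
Definition dead (Q : {poly C}) (m : R * R) := fqnorm m Q (1/2).

Lemma cut_le e e' c t Q : e <= e' -> cut e c t Q -> cut e' c t Q.
Proof.
by move=> le cQ w /cQ[a b]; split=> [/a|/b] /le_trans; apply.
Qed.

(* [Q^2 - Q] is small modulo [c - m], so the norm of [Q] modulo [c - m] is either
   close to 0 or at least close to 1. *)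
Lemma cut_idem c t Q : shadow K c -> admissible c t -> cut (1/100) c t Q ->
  exists2 r : R, 0 < r & forall m, cmod (toC (m - c)) < r -> dead Q m -> fqnorm m Q (1/8).
Proof.
move=> sc adm cQ.
have b0 : (0 : R) <= 1/64 by lra.
have b1 : (1/64 : R) < 1/32 by lra.
have [w Kw|r r0 rP] := @fiber_fqnorm c (Q * Q - Q) _ _ sc b0 b1.
  have -> : (Q * Q - Q).[toC w] = Q.[toC w] * (Q.[toC w] - 1).
    by rewrite !hornerE; ring.
  rewrite cmodM; have [a b] := cQ _ Kw.
  have n0 := cmod_ge0 (Q.[toC w]); have n1 := cmod_ge0 (Q.[toC w] - 1).
  have [l|l|E] := ltgtP t (th (c, w)); last by have := adm _ Kw; rewrite -E eqxx.
    have q1 := a l; have q2 := cmodD (Q.[toC w] - 1) 1; rewrite subrK cmod1 in q2.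
    apply: (@le_trans _ _ (101/100 * (1/100))); last by lra.
    by apply: ler_pM => //; lra.
  have q1 := b l; have q2 := cmodB Q.[toC w] 1; rewrite cmod1 in q2.
  apply: (@le_trans _ _ (1/100 * (101/100))); last by lra.
  by apply: ler_pM => //; lra.
exists r => // m mr dQ; have id := fqnormN (rP _ mr).
(* [Q = Q^2 - (Q^2 - Q)] turns a bound [M] into [M^2 + 1/32]; two rounds take 1/2 to 9/32 and then
   below 1/8. *)
have step M : fqnorm m Q M -> fqnorm m Q (M * M + 1/32).
  move=> qM; have := fqnormD (fqnormM qM qM) id.
  by rewrite (_ : Q * Q + - (Q * Q - Q) = Q)//; ring.
by apply: fqnorm_le (step _ (step _ dQ)); lra.
Qed.

(** By [cut_idem] a dead cut has norm at most 1/8. Its witness [b] is bounded because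
    [|c - y| >= d / 2] on [K]; keeping [b] and moving the base point costs at most another 1/8,
    which stays under 1/2. *)
Lemma dead_locally c t Q : shadow K c -> admissible c t -> cut (1/100) c t Q ->
  exists2 r : R, 0 < r & forall x, cmod (toC (x - c)) < r -> 0 < h x ->
    \forall y \near x, dead Q y <-> dead Q x.
Proof.
move=> sc adm cQ; have [r r0 rP] := cut_idem sc adm cQ; exists r => // x xr hx.
have [d d0 o] := not_shadow_off K_compact (positive_not_shadow K_zero hx).
have [B B0 QB] := ulim_bounded K_compact (ulim_snd K Q).
pose s := Num.min (d / 2) (Num.min (r - cmod (toC (x - c))) (d / (32 * (B + 1)))).
have s0 : 0 < s.
  by rewrite !lt_min subr_gt0 xr !divr_gt0// mulr_gt0//; lra.
have ball y : cmod (toC (y - x)) < s -> cmod (toC (y - c)) < r /\ off K (toC y) (d / 2).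
  rewrite !lt_min => /and3P[y1 y2 _]; split.
    by have := cmod_tri (toC x) (toC y) (toC c); rewrite -!toCB; lra.
  move=> k Kk; have := o _ Kk; have := cmod_tri (toC y) (toC k.1) (toC x).
  by rewrite -[toC y - toC x]toCB; lra.
have move_dead y z : cmod (toC (y - x)) < s -> cmod (toC (z - x)) < s ->
    dead Q y -> dead Q z.
  move=> ys zs dy; have [yr oy] := ball _ ys.
  have [b ub bP] := rP _ yr dy; exists b => // k Kk.
  have zy : cmod (toC (y - z)) <= d / (16 * (B + 1)).
    have := cmod_tri (toC x) (toC y) (toC z); rewrite (cmodC (toC x) (toC z)) -!toCB.
    move: ys zs; rewrite !lt_min => /and3P[_ _ ys] /and3P[_ _ zs].
    have -> : d / (16 * (B + 1)) = d / (32 * (B + 1)) + d / (32 * (B + 1)).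
      by field; rewrite gt_eqF//; lra.
    lra.
  have kb : d / 2 * cmod (b k) <= B + 1.
    have h1 := bP _ Kk; have h2 := QB _ Kk.
    have h3 := cmod_lerB ((toC k.1 - toC y) * b k) Q.[toC k.2].
    rewrite cmodC cmodM in h3.
    have h4 : d / 2 * cmod (b k) <= cmod (toC k.1 - toC y) * cmod (b k).
      by rewrite ler_wpM2r ?cmod_ge0 ?oy.
    lra.
  have -> : Q.[toC k.2] - (toC k.1 - toC z) * b k =
    (Q.[toC k.2] - (toC k.1 - toC y) * b k) - toC (y - z) * b k by rewrite toCB; ring.
  apply: le_trans (cmodB _ _) _; rewrite cmodM.
  have : cmod (toC (y - z)) * cmod (b k) <= 1/8.
    apply: (@le_trans _ _ (d / (16 * (B + 1)) * cmod (b k))).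
      by rewrite ler_wpM2r ?cmod_ge0.
    have B1 : 0 < B + 1 by lra.
    have -> : d / (16 * (B + 1)) * cmod (b k) = d / 2 * cmod (b k) / (8 * (B + 1)).
      by field; rewrite gt_eqF.
    by rewrite ler_pdivrMr ?mulr_gt0//; lra.
  by have := bP _ Kk; lra.
apply/near_cmodP; exists s => // y ys.
have xs : cmod (toC (x - x)) < s by rewrite subrr (_ : toC 0 = 0)// cmod0.
by split; apply: move_dead.
Qed.

Lemma dead_side c t Q (e : R) : shadow K c -> admissible c t -> cut (1/100) c t Q -> 0 < e ->
  exists r : R, [/\ 0 < r, r <= e & forall x y, cmod (toC (x - c)) < r ->
    cmod (toC (y - c)) < r -> 0 < h x -> 0 < h y -> (dead Q x <-> dead Q y)].
Proof.
move=> sc adm cQ e0; have [s s0 sP] := dead_locally sc adm cQ.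
have m0 : 0 < Num.min s e by rewrite lt_min s0.
have [r [r0 re rP]] := regular_zero_side_connected (shadow_regular sc) m0.
exists r; split => //; first by move: re; rewrite le_min => /andP[].
by apply: rP => x; rewrite lt_min => /andP[xs _]; exact: sP.
Qed.

(** The sheets above [t'] are among those above [t], so [Q Q'] is close to [Q'] on the fibre and the
    norm of [Q'] modulo [c - m] is at most [2/8 + 1/32]. *)
Lemma dead_mono c t t' Q Q' : shadow K c -> admissible c t -> admissible c t' -> t <= t' ->
  cut (1/100) c t Q -> cut (1/100) c t' Q' ->
  exists2 r : R, 0 < r & forall m, cmod (toC (m - c)) < r -> dead Q m -> dead Q' m.
Proof.
move=> sc adm adm' tt' cQ cQ'.
have [r1 r10 P1] := cut_idem sc adm cQ.
have a0 : (0 : R) <= 1/40 by lra.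
have a1 : (1/40 : R) < 1/32 by lra.
have b0 : (0 : R) <= 101/100 by lra.
have b1 : (101/100 : R) < 2 by lra.
have Q'b w : K (c, w) -> cmod Q'.[toC w] <= 101/100.
  move=> Kw; have [a b] := cQ' _ Kw.
  have [/a l|/b l|E] := ltgtP t' (th (c, w)); last by have := adm' _ Kw; rewrite -E eqxx.
    by have := cmodD (Q'.[toC w] - 1) 1; rewrite subrK cmod1; lra.
  by lra.
have Qb w : K (c, w) -> cmod (Q.[toC w] - 1) <= 201/100.
  move=> Kw; have [a b] := cQ _ Kw.
  have [/a l|/b l|E] := ltgtP t (th (c, w)); last by have := adm _ Kw; rewrite -E eqxx.
    by lra.
  by have := cmodB Q.[toC w] 1; rewrite cmod1; lra.
have [w Kw|r2 r20 P2] := @fiber_fqnorm c (Q * Q' - Q') _ _ sc a0 a1.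
  have -> : (Q * Q' - Q').[toC w] = (Q.[toC w] - 1) * Q'.[toC w].
    by rewrite !hornerE; ring.
  rewrite cmodM; have [a b] := cQ _ Kw; have [a' b'] := cQ' _ Kw.
  have n0 := cmod_ge0 (Q'.[toC w]); have n1 := cmod_ge0 (Q.[toC w] - 1).
  have [l|l|E] := ltgtP t' (th (c, w)); last by have := adm' _ Kw; rewrite -E eqxx.
    apply: (@le_trans _ _ (1/100 * (101/100))); last by lra.
    by apply: ler_pM => //; [apply: a; lra|exact: Q'b].
  apply: (@le_trans _ _ (201/100 * (1/100))); last by lra.
  by apply: ler_pM => //; [exact: Qb|exact: b'].
have [r3 r30 P3] := fiber_fqnorm sc b0 b1 Q'b.
exists (Num.min r1 (Num.min r2 r3)); first by rewrite !lt_min r10 r20.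
move=> m; rewrite !lt_min => /and3P[m1 m2 m3] dQ.
have := fqnormD (fqnormM (P1 _ m1 dQ) (P3 _ m3)) (fqnormN (P2 _ m2)).
rewrite (_ : Q * Q' + - (Q * Q' - Q') = Q'); last by ring.
by apply: fqnorm_le; lra.
Qed.

(** At an admissible level over the shadow the choice of [Q] does not matter: by [dead_mono] at
    equal levels, two cuts are dead at the same points near [c]. *)
Definition alive (c : R * R) (t : R) := exists2 Q, cut (1/100) c t Q &
  forall r : R, 0 < r -> exists m, [/\ cmod (toC (m - c)) < r, 0 < h m & ~ dead Q m].

Lemma alive_le c t t' Q : shadow K c -> admissible c t -> admissible c t' -> t <= t' ->
  cut (1/100) c t Q -> alive c t' ->
  forall r : R, 0 < r -> exists m, [/\ cmod (toC (m - c)) < r, 0 < h m & ~ dead Q m].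
Proof.
move=> sc adm adm' tt' cQ [Q' cQ' nd] r r0.
have [s s0 sP] := dead_mono sc adm adm' tt' cQ cQ'.
have m0 : 0 < Num.min r s by rewrite lt_min r0.
have [m [ms hm dm]] := nd _ m0; move: ms; rewrite lt_min => /andP[mr ms].
by exists m; split => // /(sP _ ms).
Qed.

(** [th] stays away from [t] on [K] near the fibre over [c], and by compactness fibres over nearby
    points lie in such a neighbourhood. Doubling [e] absorbs the variation of [Q]. *)
Lemma cut_locally c t (e : R) Q : admissible c t -> 0 < e -> cut e c t Q ->
  exists2 r : R, 0 < r & forall c' t', cmod (toC (c' - c)) < r -> `|t' - t| < r ->
    admissible c' t' /\ cut (2 * e) c' t' Q.
Proof.
move=> adm e0 cQ.
have /compact_near_coveringP/near_covering_withinP cov := K_compact.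
pose Pr (r : R) (k : T) := forall t', cmod (toC (k.1 - c)) < r -> `|t' - t| < r ->
  [/\ th k != t', t' < th k -> cmod (Q.[toC k.2] - 1) <= 2 * e &
      th k < t' -> cmod Q.[toC k.2] <= 2 * e].
have : \forall r \near (0 : R)^'+, K `<=` Pr r.
  apply: cov => x Kx; have [xc|xc] := eqVneq x.1 c; last first.
    pose d := cmod (toC (x.1 - c)); have d0 : 0 < d.
      rewrite /d cmod_gt0; apply: contra_neq xc => E.
      by apply: (@subr0_eq _ x.1 c); apply: toC_inj; rewrite E.
    exists ([set y : T | cmod (toC (y.1 - x.1)) < d / 2], [set r : R | r < d / 2]) => /=.
      split; last by apply: nbhs_right_lt; lra.
      apply: (near_fst (P := fun u => cmod (toC (u - x.1)) < d / 2)).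
      by apply/near_cmodP; exists (d / 2) => //; lra.
    move=> [y r] /= [yx rd] Ky t' yc _; exfalso.
    have := cmod_tri (toC y.1) (toC x.1) (toC c).
    by rewrite (cmodC (toC x.1) (toC y.1)) -!toCB -/d; lra.
  have xE : x = (c, x.2) by rewrite -xc; case: (x).
  have Kx2 : K (c, x.2) by rewrite -xE.
  have thx : th x != t by rewrite xE; exact: adm.
  pose g := `|th x - t|; have g0 : 0 < g by rewrite normr_gt0 subr_eq0.
  have g3 : 0 < g / 3 by lra.
  exists ([set y : T | (K y -> `|th y - th x| < g / 3) /\
      cmod (Q.[toC y.2] - Q.[toC x.2]) < e], [set r : R | r < g / 3]) => /=.
    split; last by apply: nbhs_right_lt.
    apply: filterI; first exact: th_cts.
    by apply: (near_snd (P := fun u => cmod (Q.[toC u] - Q.[toC x.2]) < e)); exact: poly_cts.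
  move=> [y r] /= [[thy Qy] rg] Ky t' _ tt'.
  have [a b] := cQ _ Kx2; rewrite -xE in a b.
  have := thy Ky; rewrite ltr_norml => /andP[y1 y2].
  have := tt'; rewrite ltr_norml => /andP[t1 t2].
  have := cmodD (Q.[toC y.2] - Q.[toC x.2]) (Q.[toC x.2] - 1); rewrite addrA subrK => q1.
  have := cmodD (Q.[toC y.2] - Q.[toC x.2]) Q.[toC x.2]; rewrite subrK => q2.
  have [l|l|E] := ltgtP t (th x); last by rewrite E eqxx in thx.
    have gE : g = th x - t by rewrite /g ger0_norm//; lra.
    have := a l; split; [by rewrite gt_eqF//; lra|by lra|by lra].
  have gE : g = t - th x by rewrite /g ler0_norm ?opprB//; lra.
  have := b l; split; [by rewrite lt_eqF//; lra|by lra|by lra].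
move=> near_r; near (0 : R)^'+ => r.
have r0 : 0 < r by near: r; exact: nbhs_right_gt.
have rP : K `<=` Pr r by near: r; exact: near_r.
by exists r => // c' t' cr tr; split=> w Kw; have [a b d] := rP _ Kw t' cr tr; [exact: a|split].
Unshelve. all: by end_near. Qed.

Hypothesis fiber_pc : forall c, polyconvex1 (fiber K c).

(** The two parts of the fibre are compact and disjoint because [th] omits [t]; this is the
    separation that [runge_indicator] requires. *)
Lemma fiber_sheet_gap c t : admissible c t -> exists2 d : R, 0 < d &
  forall x y, K (c, x) -> K (c, y) -> t < th (c, x) -> th (c, y) < t ->
    d <= cmod (toC (x - y)).
Proof.
move=> adm.
have /compact_near_coveringP/near_covering_withinP cov := K_compact.
pose Pr (d : R) (k : T) := forall y, k.1 = c -> K (c, y) -> t < th k -> th (c, y) < t ->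
  d <= cmod (toC (k.2 - y)).
have : \forall d \near (0 : R)^'+, K `<=` Pr d.
  apply: cov => x Kx; have [xc|xc] := eqVneq x.1 c; last first.
    pose d := cmod (toC (x.1 - c)); have d0 : 0 < d.
      rewrite /d cmod_gt0; apply: contra_neq xc => E.
      by apply: (@subr0_eq _ x.1 c); apply: toC_inj; rewrite E.
    exists ([set y : T | cmod (toC (y.1 - x.1)) < d], setT) => /=.
      split; last exact: filterT.
      apply: (near_fst (P := fun u => cmod (toC (u - x.1)) < d)).
      by apply/near_cmodP; exists d.
    move=> [y r] /= [yx _] Ky z yc; exfalso; move: yx; rewrite yc.
    by rewrite toCB cmodC -toCB ltxx.
  have xE : x = (c, x.2) by rewrite -xc; case: (x).
  have thx : th x != t by rewrite xE; apply: adm; rewrite -xE.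
  have g0 : 0 < `|th x - t| by rewrite normr_gt0 subr_eq0.
  have [[U1 U2] [/= nU1 nU2] UP] := th_cts Kx g0.
  have /near_cmodP[s s0 sP] := nU2.
  exists ([set y : T | y.1 \in U1 /\ cmod (toC (y.2 - x.2)) < s / 2],
    [set d : R | d < s / 2]) => /=.
    split; last by apply: nbhs_right_lt; lra.
    apply: filterI.
      by apply: (near_fst (P := fun u => u \in U1)); apply: filterS nU1 => u; exact: mem_set.
    apply: (near_snd (P := fun u => cmod (toC (u - x.2)) < s / 2)).
    by apply/near_cmodP; exists (s / 2) => //; lra.
  move=> [y d] /= [[/set_mem y1 y2] ds] Ky z yc Kz ty tz.
  rewrite leNgt; apply/negP => yz.
  have U2y : U2 y.2 by apply: sP; lra.
  have U2z : U2 z.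
    apply: sP; have := cmod_tri (toC y.2) (toC z) (toC x.2).
    by rewrite (cmodC (toC z) (toC y.2)) -!toCB; lra.
  have hy := UP y (conj y1 U2y) Ky.
  have hz : `|th (c, z) - th x| < `|th x - t|.
    by apply: (UP (c, z)) => //; split => //=; rewrite -yc.
  move: hy hz; rewrite !ltr_norml => /andP[a1 a2] /andP[b1 b2].
  have [l|l|E] := ltgtP t (th x); last by rewrite E eqxx in thx.
    by move: a1 a2 b1 b2; rewrite ger0_norm; lra.
  by move: a1 a2 b1 b2; rewrite ler0_norm; lra.
move=> near_d; near (0 : R)^'+ => d.
have d0 : 0 < d by near: d; exact: nbhs_right_gt.
have dP : K `<=` Pr d by near: d; exact: near_d.
by exists d => // x y Kx Ky tx ty; exact: (dP (c, x) Kx y).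
Unshelve. all: by end_near. Qed.

Lemma exists_cut c t (e : R) : admissible c t -> 0 < e -> exists Q, cut e c t Q.
Proof.
move=> adm e0; have [d d0 dP] := fiber_sheet_gap adm.
have [B B0 KB] := fst_snd_bounded K_compact.
pose S : set C := [set u | exists2 x, u = toC x & K (c, x)].
pose P : set C := [set u | exists2 x, u = toC x & K (c, x) /\ t < th (c, x)].
pose P' : set C := [set u | exists2 x, u = toC x & K (c, x) /\ th (c, x) < t].
have SB u : S u -> cmod u <= B by move=> [x -> /KB[]].
have S_pc l : ~ S l -> separated_by_poly S l.
  move=> nSl; pose w : R * R := (complex.Re l, complex.Im l).
  have nw : ~ phull1 (fiber K c) w.
    by rewrite fiber_pc => Kw; apply: nSl; exists w => //; rewrite toCK.
  move/existsNP: nw => [p /existsNP[M /not_implyP[pM /negP]]]; rewrite -ltNge toCK => lt.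
  by exists p, M; split => // u [x -> Kx]; exact: pM.
have cov : separated_cover S d P P'.
  split=> [u|_ _ [x -> [Kx tx]] [y -> [Ky ty]]]; last by rewrite -toCB dP.
  split=> [[x -> Kx]|[[x -> []]|[x -> []]]]; [|by exists x|by exists x].
  have [l|l|E] := ltgtP t (th (c, x)); last by have := adm _ Kx; rewrite -E eqxx.
    by left; exists x.
  by right; exists x.
have [Q [Q1 Q2]] := runge_indicator d0 SB S_pc cov e0.
exists Q => w Kw; split=> tw; [apply: Q1|apply: Q2]; by exists w.
Qed.

(** A cut of quality 1/200 at [(c, t)] is one of quality 1/100 at all nearby [(c', t')]. Whether it
    is dead is constant on the positive side near [c], which contains the positive side near
    [c']. *)
Lemma alive_locally c t : shadow K c -> admissible c t ->
  exists2 r : R, 0 < r & forall c' t', shadow K c' -> cmod (toC (c' - c)) < r ->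
    `|t' - t| < r -> admissible c' t' /\ (alive c' t' <-> alive c t).
Proof.
move=> sc adm; have e0 : (0 : R) < 1/200 by lra.
have [Q cQ] := exists_cut adm e0.
have cQ1 : cut (1/100) c t Q by apply: cut_le cQ; lra.
have [r1 r10 P1] := cut_locally adm e0 cQ.
have [r2 [r20 _ P2]] := dead_side sc adm cQ1 (@ltr01 R).
exists (Num.min r1 (r2 / 2)); first by rewrite lt_min r10 divr_gt0.
move=> c' t' sc'; rewrite !lt_min => /andP[c1 c2] /andP[t1 _].
have [adm' cQ''] := P1 _ _ c1 t1.
have cQ' : cut (1/100) c' t' Q by apply: cut_le cQ''; lra.
split => //; have h20 : 0 < r2 / 2 by lra.
have incl x : cmod (toC (x - c')) < r2 / 2 -> cmod (toC (x - c)) < r2.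
  by have := cmod_tri (toC c') (toC x) (toC c); rewrite -!toCB; lra.
split=> al; exists Q => // r r0.
  have [m [ms hm dm]] := alive_le sc' adm' adm' (lexx _) cQ' al h20.
  have mr : 0 < Num.min r r2 by rewrite lt_min r0.
  have [x xr hx] := regular_zero_side (shadow_regular sc) mr.
  move: xr; rewrite lt_min => /andP[xr xr2]; exists x; split => //.
  by rewrite (P2 x m)//; exact: incl.
have [m [ms hm dm]] := alive_le sc adm adm (lexx _) cQ1 al r20.
have mr : 0 < Num.min r (r2 / 2) by rewrite lt_min r0.
have [x xr hx] := regular_zero_side (shadow_regular sc') mr.
move: xr; rewrite lt_min => /andP[xr xr2]; exists x; split => //.
by rewrite (P2 x m)//; exact: incl.
Qed.

End Sheets.

(** * The top living sheet *)

Section Angle.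
Variable R : realType.
Local Notation C := R[i].
Local Notation T := ((R * R) * (R * R))%type.
Variables (K : set T) (h : R * R -> R).
Hypothesis K_compact : compact K.
Hypothesis h_regular : forall p, h p = 0 -> regular_zero h p.
Hypothesis K_zero : forall k, K k -> h k.1 = 0.
Hypothesis neg_free : forall p, shadow K p -> side_free K (fun x => - h x) p.
Hypothesis fiber_pc : forall c, polyconvex1 (fiber K c).
Variable th : T -> R.
Hypothesis th_cts : forall k (e : R), K k -> 0 < e ->
  \forall x \near k, K x -> `|th x - th k| < e.
Variable l0 : R * R.
Hypothesis l0_out : ~ shadow K l0.
Hypothesis th_arg : forall k, K k -> is_arg l0 k.1 (th k).
Hypothesis pos_not_free : forall p, shadow K p -> ~ side_free K h p.

Local Notation alive := (alive K h th).

Lemma shadow_neq c : shadow K c -> c <> l0.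
Proof. by move=> sc E; apply: l0_out; rewrite -E. Qed.

Lemma is_arg_circ c s t : c <> l0 -> is_arg l0 c s -> is_arg l0 c t -> circ s = circ t.
Proof. by move=> cl /is_arg_direction <- // /is_arg_direction <-. Qed.

Lemma circ_neqN (t : R) : circ t <> - circ t.
Proof.
case=> /eqP; rewrite -addr_eq0 -mulr2n mulrn_eq0 /= => /eqP c0 /eqP.
rewrite -addr_eq0 -mulr2n mulrn_eq0 /= => /eqP s0.
by have /eqP := cos2Dsin2 t; rewrite c0 s0 expr0n /= addr0 eq_sym oner_eq0.
Qed.

(** Over [c] the values of [th] are congruent to [t] modulo 2 pi, and these two levels lie halfway
    between. *)
Lemma admissible_arg c t : shadow K c -> is_arg l0 c t ->
  admissible K th c (t - pi) /\ admissible K th c (t + pi).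
Proof.
move=> sc ct; have cl := shadow_neq sc; split=> w Kw; apply/eqP => E;
  have := is_arg_circ cl (th_arg Kw) ct; rewrite E.
  by move=> H; have := circDpi (t - pi); rewrite subrK -H; exact: circ_neqN.
by rewrite circDpi => /esym; exact: circ_neqN.
Qed.

(** Between the levels [t - pi] and [t + pi] the only possible value of [th] is [t], so [t] labels
    the highest living sheet. *)
Definition top_angle c t :=
  [/\ is_arg l0 c t, alive c (t - pi) & ~ alive c (t + pi)].

(** Distinct arguments differ by at least 2 pi, so the lower level of the larger is not below the
    upper level of the smaller, and being alive passes down. *)
Lemma top_angle_unique c s t : shadow K c -> top_angle c s -> top_angle c t -> s = t.
Proof.
move=> sc; wlog st : s t / s < t.
  by move=> H ts tt; have [/H|/H|//] := ltgtP s t; [exact|move=> /(_ tt ts)].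
move=> [as_ _ nd] [at_ al _]; have cl := shadow_neq sc.
have gap := circ_gap (is_arg_circ cl as_ at_) st.
have [_ adm] := admissible_arg sc as_; have [adm' _] := admissible_arg sc at_.
have le : s + pi <= t - pi by move: gap; rewrite mulr2n; lra.
case: nd; have e0 : (0 : R) < 1/100 by lra.
have [Q cQ] := exists_cut K_compact th_cts fiber_pc adm e0.
exists Q => // r r0.
exact: (alive_le K_compact h_regular K_zero neg_free sc adm adm' le cQ al r0).
Qed.

Lemma angle_bounded : exists2 B : R, 0 <= B & forall k, K k -> `|th k| <= B.
Proof.
have /compact_near_coveringP/near_covering_withinP cov := K_compact.
have : \forall n \near \oo, K `<=` fun k => `|th k| <= n%:R.
  apply: cov => x Kx; exists ([set y | K y -> `|th y - th x| < 1],
      [set n : nat | `|th x| + 1 <= n%:R]) => /=.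
    split; first exact: th_cts.
    exists (Num.truncn (`|th x| + 1)).+1 => // n /= nP.
    by apply: (le_trans (ltW (truncnS_gt _))); rewrite ler_nat.
  move=> [y n] /= [yx xn] Ky; have := ler_normD (th y - th x) (th x); rewrite subrK.
  by have := yx Ky; lra.
by move=> /filter_ex[n nP]; exists n%:R => // k Kk; exact: nP.
Qed.

Lemma top_angle_exists c : shadow K c -> exists t, top_angle c t.
Proof.
move=> sc; have [B B0 thB] := angle_bounded.
have [w Kw] := sc; have pi0 := pi_gt0 R.
(* [2 N pi > 4 B], so shifting by [N] periods leaves the range of [th]; [N] is a successor, so
   subtracting [pi] at the top costs at most half of the shift. *)
pose N := (Num.truncn (2 * B / pi)).+1.
have NB : 2 * B < N%:R * pi by rewrite -ltr_pdivrMr//; exact: truncnS_gt.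
have twoN : (pi *+ 2) *+ N = 2 * (N%:R * pi) :> R.
  by rewrite -mulr_natr -[pi *+ 2]mulr_natr; ring.
pose s := th (c, w) - (pi *+ 2) *+ N.
pose t j := s + (pi *+ 2) *+ j.
have at_ j : is_arg l0 c (t j).
  have E i : circ (s + (pi *+ 2) *+ i) = circ s.
    by elim: i => [|i IH]; rewrite ?mulr0n ?addr0// mulrSr addrA circD2pi.
  have := th_arg Kw; rewrite /is_arg /= /t E.
  by rewrite -(E N) /s subrK.
(* Below all values of [th] the constant 1 is a cut; if it were dead at [m], [qnorm1_free] would
   make [m] free. *)
have low : alive c (t 0%N - pi).
  exists 1 => [w' Kw'|r r0].
    split=> [_|lt]; first by rewrite hornerE subrr cmod0; lra.
    have := thB _ Kw'; have := thB _ Kw; rewrite !ler_norml => /andP[_ a] /andP[b _].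
    move: lt; rewrite /t /s mulr0n addr0 twoN; lra.
  have [m [mr hm nf]] := not_side_free sc (pos_not_free sc) r0; exists m; split => // dm.
  have [d d0 o] := not_shadow_off K_compact (positive_not_shadow K_zero hm).
  apply: nf; apply: (@qnorm1_free _ K K_compact _ d (1/2)) => //; first by lra.
  by apply: qnorm_eq dm => k _; rewrite hornerE.
(* Above all values of [th] the constant 0 is a cut, dead everywhere. *)
have high : ~ alive c (t (N + N)%N - pi).
  have adm : admissible K th c (t (N + N)%N - pi) by have [] := admissible_arg sc (at_ (N + N)%N).
  move=> al; have c0 : cut K th (1/100) c (t (N + N)%N - pi) 0.
    move=> w' Kw'; split=> [lt|_]; last by rewrite horner0 cmod0; lra.
    have := thB _ Kw'; have := thB _ Kw; rewrite !ler_norml => /andP[a _] /andP[_ b].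
    have tE : t (N + N)%N = th (c, w) + 2 * (N%:R * pi).
      by rewrite /t /s mulrnDr addrA subrK twoN.
    have N1 : 1 * pi <= N%:R * pi :> R by apply: ler_wpM2r; [exact: ltW|rewrite ler1n].
    by move: lt; rewrite tE; rewrite mul1r in N1; lra.
  have [m [_ _ dm]] := alive_le K_compact h_regular K_zero neg_free sc adm adm (lexx _) c0 al ltr01.
  apply: dm; apply: qnorm_bound => k _; rewrite horner0 cmod0; lra.
have [j [a b]] : exists j, alive c (t j - pi) /\ ~ alive c (t j.+1 - pi).
  apply: contrapT => H.
  have all_alive j : alive c (t j - pi).
    by elim: j => // j IH; apply: contrapT => na; apply: H; exists j.
  exact: high.
exists (t j); split => //; suff <- : t j.+1 - pi = t j + pi by [].
by rewrite /t mulrSr mulr2n; ring.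
Qed.

Lemma top_angle_near c t (e : R) : shadow K c -> top_angle c t -> 0 < e ->
  \forall c' \near c, shadow K c' -> exists2 t', `|t' - t| < e & top_angle c' t'.
Proof.
move=> sc [at_ al nal] e0; have [adm adm'] := admissible_arg sc at_.
have [r1 r10 P1] := alive_locally K_compact h_regular K_zero neg_free th_cts fiber_pc sc adm.
have [r2 r20 P2] := alive_locally K_compact h_regular K_zero neg_free th_cts fiber_pc sc adm'.
have m0 : 0 < Num.min e (Num.min r1 r2) by rewrite !lt_min e0 r10.
have near_a := is_arg_near (shadow_neq sc) at_ m0.
have near_r : \forall c' \near c, cmod (toC (c' - c)) < Num.min r1 r2.
  by apply/near_cmodP; exists (Num.min r1 r2) => //; rewrite lt_min r10.
near=> c' => sc'.
have [t' tt' at'] : exists2 t', `|t' - t| < Num.min e (Num.min r1 r2) & is_arg l0 c' t'.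
  by near: c'.
have : cmod (toC (c' - c)) < Num.min r1 r2 by near: c'.
rewrite lt_min => /andP[c1 c2]; move: tt'; rewrite !lt_min => /and3P[te t1 t2].
exists t' => //.
have [|_ E1] := P1 c' (t' - pi) sc' c1; first by rewrite opprB addrA subrK.
have [|_ E2] := P2 c' (t' + pi) sc' c2; first by rewrite opprD addrACA subrr addr0.
by split; rewrite ?E1 ?E2.
Unshelve. all: by end_near. Qed.

Lemma exists_angle : exists2 Th : R * R -> R, {within shadow K, continuous Th} &
  forall c, shadow K c -> is_arg l0 c (Th c).
Proof.
pose Th c := if pselect (shadow K c) is left sc then projT1 (cid (top_angle_exists sc)) else 0.
have ThP c : shadow K c -> top_angle c (Th c).
  by move=> sc; rewrite /Th; case: pselect => // sc'; exact: projT2 (cid (top_angle_exists sc')).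
exists Th => [|c /ThP[]//].
apply/subspace_continuousP => c sc; apply/cvgrPdist_lt => e e0.
have := top_angle_near sc (ThP _ sc) e0; apply: filterS => c' H sc'.
have [t' tt' mt'] := H sc'.
by move: tt'; rewrite -(top_angle_unique sc' (ThP _ sc') mt') distrC.
Qed.

(** [N] is open with frontier in the shadow because freeness is locally constant off the shadow, and
    bounded because distant points are free. *)
Lemma no_angle : ~ free K (toC l0) -> False.
Proof.
move=> nf; have [Th cTh Tharg] := exists_angle.
have [B B0 KB] := fst_snd_bounded K_compact.
pose N := [set x | ~ shadow K x /\ ~ free K (toC x)].
apply: (@no_logarithm R N (shadow K) Th l0) => //.
- exact: shadow_compact.
- by move=> x [].
- move=> x [sx fx]; have := near_not_shadow K_compact sx.
  by have := free_locally K_compact sx; apply: filterS2 => y fy sy; split => //; rewrite fy.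
- move=> x nNx sx; have fx : free K (toC x) by apply: contrapT => nfx; apply: nNx.
  by have := free_locally K_compact sx; apply: filterS => y fy [_]; rewrite fy.
exists (2 * B + 1 + cmod (toC l0)) => x [_ nfx].
have := cmodB (toC x) (toC l0); rewrite -toCB.
suff : cmod (toC x) <= 2 * B + 1 by lra.
rewrite leNgt; apply/negP => lt; apply: nfx.
by apply: (free_far K_compact (B := B)) => [k /KB[]||] //; lra.
Qed.

End Angle.

(** * The hull *)

Section Hull.
Variable R : realType.
Local Notation C := R[i].
Local Notation T := ((R * R) * (R * R))%type.
Variables (K : set T) (h : R * R -> R).
Hypothesis K_compact : compact K.
Hypothesis K_connected : connected K.
Hypothesis K_sc : simply_coconnected K.
Hypothesis fiber_pc : forall c, polyconvex1 (fiber K c).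
Hypothesis h_regular : forall p, h p = 0 -> regular_zero h p.
Hypothesis K_zero : forall k, K k -> h k.1 = 0.
Hypothesis neg_free : forall p, shadow K p -> side_free K (fun x => - h x) p.

Lemma exp_angle (l0 : R * R) : ~ shadow K l0 -> exists2 th : T -> R,
  (forall k (e : R), K k -> 0 < e -> \forall x \near k, K x -> `|th x - th k| < e) &
  forall k, K k -> is_arg l0 k.1 (th k).
Proof.
move=> nl0; have [||psi [cpsi psiE]] := K_sc (f := fun k => k.1 - l0).
- apply: continuous_subspaceT => k; apply: cvgB; [exact: cvg_fst|exact: cvg_cst].
- move=> k Kk; apply/eqP => /subr0_eq E; apply: nl0; rewrite -E; exact: shadow_fst.
exists (fun k => (psi k).2) => [k e Kk e0|k Kk].
  move/subspace_continuousP: cpsi => /(_ k Kk) cpsi.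
  have c2 : (psi x).2 @[x --> within K (nbhs k)] --> (psi k).2.
    exact: (cvg_comp _ _ cpsi (@cvg_snd _ _ (nbhs (psi k).1) (nbhs (psi k).2) _)).
  move/cvgrPdist_lt: c2 => /(_ e e0) c2.
  have c3 : \forall x \near k, K x -> `|(psi k).2 - (psi x).2| < e by exact: c2.
  by apply: filterS c3 => x + Kx => /(_ Kx); rewrite distrC.
have E : k.1 - l0 = expR (psi k).1 *: circ (psi k).2 by rewrite psiE.
by rewrite /is_arg [in RHS]E cmod_scale cmod_circ mulr1 gtr0_norm ?expR_gt0.
Qed.

Lemma pos_free p : shadow K p -> side_free K h p.
Proof.
move=> sp; apply: contrapT => nf.
have npos q : shadow K q -> ~ side_free K h q.
  move=> sq fq; apply: nf.
  exact: (side_free_all K_compact h_regular K_zero K_connected sq sp fq).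
have [l0 [_ hl0 nfl0]] := not_side_free sp nf ltr01.
have nl0 := positive_not_shadow K_zero hl0.
have [th th_cts th_arg] := exp_angle nl0.
exact: (no_angle K_compact h_regular K_zero neg_free fiber_pc th_cts nl0 th_arg npos nfl0).
Qed.

(** A segment towards infinity may cross the shadow. As both sides are free, being in the shadow or
    free is locally constant even at the crossings. *)
Lemma not_shadow_free x : ~ shadow K x -> free K (toC x).
Proof.
move=> nx; have [B B0 KB] := fst_snd_bounded K_compact.
pose y : R * R := (2 * B + 1, 0).
have fy : free K (toC y).
  have yn : 2 * B + 1 <= cmod (toC y).
    by apply: le_trans (cmod_fst y); exact: ler_norm.
  by apply: (free_far K_compact (B := B)) => [k /KB[]||] //; lra.
suff [_] : (shadow K x \/ free K (toC x)) <-> (shadow K y \/ free K (toC y)).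
  by case; [by right|by move=> /nx|by []].
apply: (@segment_locally_constant R (fun x => shadow K x \/ free K (toC x))) => t _.
set z := x + _; have [sz|nz] := pselect (shadow K z); last first.
  have := near_not_shadow K_compact nz; have := free_locally K_compact nz.
  by apply: filterS2 => u fu su; rewrite fu; tauto.
have [r1 r10 P1] := pos_free sz; have [r2 r20 P2] := neg_free sz.
have [r3 r30 P3] := regular_zero_dense_side (shadow_regular h_regular K_zero sz).
have m0 : 0 < Num.min r1 (Num.min r2 r3) by rewrite !lt_min r10 r20.
apply/near_cmodP; exists (Num.min r1 (Num.min r2 r3)) => // u.
rewrite !lt_min => /and3P[u1 u2 u3]; split=> _; first by left.
have [su|nu] := pselect (shadow K u); [by left|right].
have [hu|hu|hu] := ltgtP (h u) 0; [by apply: P2 => //; rewrite oppr_gt0|exact: P1|].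
(* Here [h] vanishes at [u] although [u] is off the shadow; freeness comes from a nearby point with
   [h > 0]. *)
have /near_cmodP[s s0 sP] := free_locally K_compact nu.
have ms : 0 < Num.min s (r1 - cmod (toC (u - z))) by rewrite lt_min s0 subr_gt0.
have [v vu hv] := P3 u _ u3 hu ms; move: vu; rewrite lt_min => /andP[vs vr].
apply/(sP v vs)/P1 => //.
by have := cmod_tri (toC u) (toC v) (toC z); rewrite -!toCB; lra.
Qed.

(** Evaluation at a hull point is bounded by the supremum over [K] and kills multiples of [c - z.1],
    hence is bounded by the quotient norm. [D] bounds [|c - z.1|] on [K], the factor on the error
    when [b] becomes a polynomial. *)
Lemma hull_qnorm z P (M : R) : phull2 K z -> qnorm K (toC z.1) (peval2 P) M ->
  cmod (peval2 P z) <= M.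
Proof.
move=> hz [b ub bM]; apply/ler_addgt0Pl => e e0.
have [B B0 KB] := fst_snd_bounded K_compact.
pose D := B + cmod (toC z.1) + 1.
have D0 : 0 < D by rewrite /D; have := cmod_ge0 (toC z.1); lra.
have [Q QP] := ub (e / D) (divr_gt0 e0 D0).
pose F : {poly {poly C}} := P - ('X - (toC z.1)%:P)%:P * Q.
have FE k : peval2 F k = peval2 P k - (toC k.1 - toC z.1) * peval2 Q k.
  rewrite /F -[- (_ * Q)]mulNr -polyCN peval2D peval2M peval2_fst !hornerE.
  by ring.
have := hz F (M + e); rewrite FE subrr mul0r subr0 => H.
rewrite addrC.
apply: H => k Kk; rewrite FE.
have -> : peval2 P k - (toC k.1 - toC z.1) * peval2 Q k =
  (peval2 P k - (toC k.1 - toC z.1) * b k) + (toC k.1 - toC z.1) * (b k - peval2 Q k) by ring.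
apply: le_trans (cmodD _ _) _; rewrite lerD ?bM// cmodM.
have -> : e = D * (e / D) by rewrite mulrC divfK// gt_eqF.
apply: ler_pM; rewrite ?cmod_ge0 ?QP//.
by have := cmodB (toC k.1) (toC z.1); have [+ _] := KB _ Kk; rewrite /D; lra.
Qed.

Lemma hull_sub : phull2 K `<=` K.
Proof.
move=> [l w] hz; have [sl|nl] := pselect (shadow K l); last first.
  (* Off the shadow the quotient is zero, and evaluating the constant 1 at the hull point would give
     [1 <= 0]. *)
  have [d d0 o] := not_shadow_off K_compact nl.
  have q0 := free_qnorm K_compact d0 o (not_shadow_free nl) (ulim_peval2 K 1).
  have := @hull_qnorm (l, w) 1 0 hz q0.
  by rewrite -[1]/(1%:P%:P) peval2_const cmod1 ler10.
suff : phull1 (fiber K l) w by rewrite fiber_pc.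
move=> p M pM; have [w' Kw'] := sl.
have M0 : 0 <= M by apply: le_trans (pM _ Kw'); exact: cmod_ge0.
apply/ler_addgt0Pl => e e0; rewrite addrC.
have MMe : M < M + e by lra.
have [r r0 rP] := fiber_fqnorm K_compact h_regular K_zero neg_free sl M0 MMe pM.
have ll : cmod (toC (l - l)) < r by rewrite subrr (_ : toC 0 = 0)// cmod0.
have q : qnorm K (toC (l, w).1) (peval2 (map_poly polyC p)) (M + e).
  by apply: qnorm_eq (rP _ ll) => k _; rewrite peval2_snd.
by have := hull_qnorm hz q; rewrite peval2_snd.
Qed.

End Hull.

Lemma polyconvex2_of_regular (R : realType) (K : set ((R * R) * (R * R))) (h : R * R -> R) :
  compact K -> connected K -> simply_coconnected K ->
  (forall c, polyconvex1 (fiber K c)) ->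
  (forall p, h p = 0 -> regular_zero h p) -> (forall k, K k -> h k.1 = 0) ->
  polyconvex2 K.
Proof.
move=> cK conK scK fK hr K0; apply/seteqP; split; last by move=> z Kz P M; apply.
have [[k Kk]|/set0P/negP/negPn/eqP KE] := pselect (K !=set0); last first.
  (* For empty [K] the bound -1 on the zero polynomial holds vacuously on [K] and fails at [z]. *)
  move=> z /(_ 0 (-1)); rewrite KE peval2E !horner0 cmod0 => H.
  by have := H (fun k => False_ind _); lra.
have [p sp [fp|fp]] := exists_free_side cK hr K0 (ex_intro _ k Kk).
  (* A sign change of [h] makes the free side the negative one. *)
  have hN : (fun x => - - h x) = h by apply/funext => x; rewrite opprK.
  apply: (@hull_sub R K (fun x => - h x)) => //; first exact: regular_zeroN_all.
    by move=> k' /K0 ->; rewrite oppr0.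
  move=> q sq; rewrite hN; exact: (side_free_all cK hr K0 conK sp sq fp).
apply: (@hull_sub R K h) => // q sq.
have K0N k' : K k' -> - h k'.1 = 0 by move=> /K0 ->; rewrite oppr0.
exact: (side_free_all cK (regular_zeroN_all hr) K0N conK sp sq fp).
Qed.

Unset Implicit Arguments.

Theorem theorem1p4 (R : realType) (h : R * R -> R)
  (K : set ((R * R) * (R * R))) :
  smooth2 h ->
  (forall p : R * R, h p = 0 -> exists v : R * R, 'd h p v != 0) ->
  (forall c w : R * R, K (c, w) -> h c = 0) ->
  compact K -> connected K -> simply_coconnected K ->
  (forall c : R * R, polyconvex1 (fiber K c)) ->
  polyconvex2 K.
Proof.
move=> sm dh K0 cK conK scK fK; apply: (polyconvex2_of_regular cK conK scK fK (h := h)).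
  by move=> p hp; exact: smooth_regular_zero sm hp (dh p hp).
by move=> [c w] /K0.
Qed.
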